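(* Let $A\in\mathbb{R}^{m\times n}$ ($m<n$) and $M\in\mathbb{R}^{m\times q}$ ($m\le q$) with $\mathrm{rank}(A)=\mathrm{rank}(M)=m$, and let $y\in\mathbb{R}^m$, $\tau\ge 0$, $\alpha\in[0,1]$ be given. Suppose that one of the following conditions holds: (a) $A$ (with $\ell_2$-normalized columns) satisfies the mutual coherence property $\mu_1(k)+\mu_1(k-1)<1$; (b) $A$ satisfies the RIP of order $2k$ with constant $\delta_{2k}<1/\sqrt2$; (c) $A$ satisfies the stable NSP of order $k$ with constant $\rho\in(0,1)$; (d) $A$ satisfies the robust NSP of order $k$ with constants $\rho'\in(0,1)$ and $\rho''>0$; (e) $A$ satisfies the NSP of order $k$; (f) $A^T$ satisfies the RSP of order $k$. Consider the problem $$(\mathrm{P})\qquad \min_{x}\{\|x\|_1:\ \alpha\|M^T(Ax-y)\|_\infty+(1-\alpha)\|M^T(Ax-y)\|_1\le\tau\}.$$ Then for any $x\in\mathbb{R}^n$ there is an optimal solution $x^*$ of $(\mathrm{P})$ with $$\|x-x^*\|_2\le\gamma\left\{\left(\alpha\|\vartheta\|_\infty+(1-\alpha)\|\vartheta\|_1-\tau\right)^++2\sigma_k(x)_1+c(\tau+\|\vartheta\|_\infty)\right\},$$ where $\vartheta=M^T(Ax-y)$, $$c=\max_{G\subseteq\{1,\dots,q\},\,|G|=m}\{\|M_G^{-1}(AA^T)^{-1}A\|_{\infty\to1}:\ M_G\in\mathbb{R}^{m\times m}\text{ is an invertible submatrix of }M\},$$ and $\gamma=\sigma_{\infty,2}(M^1,M^2)$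 is the Robinson's constant of the pair $(M^1,M^2)$ defined in the context. In particular, for any $x$ satisfying the constraint of $(\mathrm{P})$ there is an optimal solution $x^*$ of $(\mathrm{P})$ with $$\|x-x^*\|_2\le\gamma\{2\sigma_k(x)_1+c\tau+c\|M^T(Ax-y)\|_\infty\}\le2\gamma\{\sigma_k(x)_1+c\tau\}.$$
   Context: Notation: $(s)^+=\max\{s,0\}$; $\sigma_k(x)_1=\inf_u\{\|x-u\|_1:\|u\|_0\le k\}$, where $\|u\|_0$ is the number of nonzero entries; $M_G$ is the submatrix of $M$ consisting of columns indexed by $G$; $\|Q\|_{\infty\to1}=\max_{\|x\|_\infty\le1}\|Qx\|_1$; for $S\subseteq\{1,\dots,n\}$, $\overline S$ is its complement and $\zeta_S$ the subvector of $\zeta$ indexed by $S$. Matrix conditions. Mutual coherence: for $A$ with $\ell_2$-normalized columns $a_1,\dots,a_n$, $\mu_1(k)=\max_{i}\max\{\sum_{j\in S}|a_i^Ta_j|:\ S\subseteq\{1,\dots,n\},\ |S|=k,\ i\notin S\}$ (with $1\le k\le n-1$, and $\mu_1(0)=0$). RIP of order $k$ with constant $\delta_k\in(0,1)$: $(1-\delta_k)\|x\|_2^2\le\|Ax\|_2^2\le(1+\delta_k)\|x\|_2^2$ for all $k$-sparse $x$ (at most $k$ nonzero entries). NSP of order $k$: $\|\zeta_S\|_1<\|\zeta_{\overline S}\|_1$ for all $\zeta\ne0$ with $A\zeta=0$ and all $|S|\le k$. Stable NSP of order $k$ with constant $\rho\in(0,1)$: $\|\zeta_S\|_1\le\rho\|\zeta_{\overline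 S}\|_1$ for all $\zeta\neq 0$ with $A\zeta=0$ and all $|S|\le k$. Robust NSP of order $k$ with constants $\rho'\in(0,1)$, $\rho''>0$: $\|\zeta_S\|_1\le\rho'\|\zeta_{\overline S}\|_1+\rho''\|A\zeta\|$ for all $\zeta\in\mathbb{R}^n$ and all $|S|\le k$, where $\|\cdot\|$ is a norm on $\mathbb{R}^m$. RSP of order $k$ of $A^T$: for any disjoint $S_1,S_2\subseteq\{1,\dots,n\}$ with $|S_1|+|S_2|\le k$ there exists $\zeta\in\mathcal{R}(A^T)$ (the range of $A^T$) with $\zeta_i=1$ for $i\in S_1$, $\zeta_i=-1$ for $i\in S_2$, and $|\zeta_i|<1$ for $i\notin S_1\cup S_2$. Robinson's constant: for $M'\in\mathbb{R}^{p_1\times r}$, $M''\in\mathbb{R}^{p_2\times r}$ let $$\mu_{\alpha_1,\alpha_2}(M',M'')=\max_{(d',d'')\in\mathcal F,\ \|(d',d'')\|_{\alpha_2}\le1}\ \min_{u\in\mathbb{R}^r}\{\|u\|_{\alpha_1}:\ M'u\le d',\ M''u=d''\},$$ with $\mathcal F=\{(d',d''):\ M'u\le d',\ M''u=d''\text{ for some }u\in\mathbb{R}^r\}$ (this is a finite number). For $N^1\in\mathbb{R}^{m_1\times\ell}$, $N^2\in\mathbb{R}^{m_2\times\ell}$, $$\sigma_{\alpha_1,\alpha_2}(N^1,N^2)=\max_{S\subseteq\{1,\dots,m_1\}}\mu_{\alpha_1,\alpha_2}\left(\begin{bmatrix}I_S&0\\-I&0\end{bmatrix},\begin{bmatrix}N^1\\N^2\end{bmatrix}^T\right),$$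 where $I$ is the $m_1\times m_1$ identity, $I_S$ consists of the rows of $I$ indexed by $S$, and the first matrix has $m_1+m_2$ columns. The matrices $M^1,M^2$: let $\mathbf e\in\mathbb{R}^q$ and $\widetilde{\mathbf e}\in\mathbb{R}^n$ be vectors of ones. The block columns have sizes $n,n,1,q,n,n,1,q,q,q,q$, $I$ and $0$ being identity and zero blocks of suitable sizes: $$M^1=\begin{bmatrix} I&-I&0&0&0&0&0&0&0&0&0\\ -I&-I&0&0&0&0&0&0&0&0&0\\ 0&0&\alpha&(1-\alpha)\mathbf e^T&0&0&0&0&0&0&0\\ M^TA&0&-\mathbf e&0&0&0&0&0&0&0&0\\ -M^TA&0&-\mathbf e&0&0&0&0&0&0&0&0\\ M^TA&0&0&-I&0&0&0&0&0&0&0\\ -M^TA&0&0&-I&0&0&0&0&0&0&0\\ 0&0&0&0&I&I&0&0&0&0&0\\ 0&0&0&0&0&0&-\alpha&\mathbf e^T&\mathbf e^T&0&0\\ 0&0&0&0&0&0&-(1-\alpha)\mathbf e&0&0&I&I\\ 0&0&0&0&-I&0&0&0&0&0&0\\ 0&0&0&0&0&-I&0&0&0&0&0\\ 0&0&0&0&0&0&-1&0&0&0&0\\ 0&0&0&0&0&0&0&-I&0&0&0\\ 0&0&0&0&0&0&0&0&-I&0&0\\ 0&0&0&0&0&0&0&0&0&-I&0\\ 0&0&0&0&0&0&0&0&0&0&-I \end{bmatrix},$$ $$M^2=\begin{bmatrix} 0&0&0&0&-I&I&0&A^TM&-A^TM&-A^TM&A^TM\\ 0&\widetilde{\mathbf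 e}^T&0&0&0&0&\tau&-y^TM&y^TM&y^TM&-y^TM \end{bmatrix}.$$ *)

(* Defs.v *)
From HB Require Import structures.
From mathcomp Require Import all_boot all_order all_algebra.
From mathcomp Require Import classical_sets reals matrix_normedtype normed_module.

Set Implicit Arguments.
Unset Strict Implicit.
Unset Printing Implicit Defensive.

Import Order.TTheory GRing.Theory Num.Theory.
Import numFieldNormedType.Exports.
Local Open Scope ring_scope.

(* Maxima and minima over infinite sets are written with [sup] and [inf];
   in each use below the set is nonempty and bounded on the relevant side, so
   these are the true extremal values. Finite maxima of nonnegative quantities
   are big operators over [Num.max] with default value 0. *)

Section Norms.
Variable R : realType.

Definition l0norm n (v : 'cV[R]_n) : nat := #|[set i | v i 0 != 0]|.

Definition l1norm n (v : 'cV[R]_n) : R := \sum_i `|v i 0|.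

Definition l2norm n (v : 'cV[R]_n) : R := Num.sqrt (\sum_i v i 0 ^+ 2).

(* The canonical norm on matrices is the entrywise maximum norm. *)
Definition linfnorm n (v : 'cV[R]_n) : R := `|v|.

Definition is_norm n (N : 'cV[R]_n -> R) : Prop :=
  [/\ forall v, N v = 0 -> v = 0,
      forall a v, N (a *: v) = `|a| * N v
    & forall u v, N (u + v) <= N u + N v].

Definition norm_infty_to_1 p r (Q : 'M[R]_(p, r)) : R :=
  sup [set l1norm (Q *m x) | x in [set x : 'cV[R]_r | linfnorm x <= 1]]%classic.

(* sigma_k(x)_1 *)
Definition best_approx1 n (k : nat) (x : 'cV[R]_n) : R :=
  inf [set l1norm (x - u) | u in [set u : 'cV[R]_n | (l0norm u <= k)%N]]%classic.

Definition subvec n (S : {set 'I_n}) (v : 'cV[R]_n) : 'cV[R]_#|S| :=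
  rowsub (@enum_val _ (mem S)) v.

End Norms.

Section MatrixConditions.
Variables (R : realType) (m n : nat) (A : 'M[R]_(m, n)).

Definition l2_normalized : Prop := forall j, l2norm (col j A) = 1.

Definition mutual_coherence (k : nat) : R :=
  \big[Num.max/0]_(i < n)
    \big[Num.max/0]_(S : {set 'I_n} | (#|S| == k) && (i \notin S))
      \sum_(j in S) `|((col i A)^T *m col j A) 0 0|.

Definition RIP (k : nat) (delta : R) : Prop :=
  forall x : 'cV[R]_n, (l0norm x <= k)%N ->
    (1 - delta) * l2norm x ^+ 2 <= l2norm (A *m x) ^+ 2
    /\ l2norm (A *m x) ^+ 2 <= (1 + delta) * l2norm x ^+ 2.

Definition NSP (k : nat) : Prop :=
  forall zeta : 'cV[R]_n, zeta != 0 -> A *m zeta = 0 ->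
  forall S : {set 'I_n}, (#|S| <= k)%N ->
    l1norm (subvec S zeta) < l1norm (subvec (~: S) zeta).

Definition stable_NSP (k : nat) (rho : R) : Prop :=
  forall zeta : 'cV[R]_n, zeta != 0 -> A *m zeta = 0 ->
  forall S : {set 'I_n}, (#|S| <= k)%N ->
    l1norm (subvec S zeta) <= rho * l1norm (subvec (~: S) zeta).

Definition robust_NSP (N : 'cV[R]_m -> R) (k : nat) (rho1 rho2 : R) : Prop :=
  forall (zeta : 'cV[R]_n) (S : {set 'I_n}), (#|S| <= k)%N ->
    l1norm (subvec S zeta)
      <= rho1 * l1norm (subvec (~: S) zeta) + rho2 * N (A *m zeta).

(* A property of the transpose of [A]: zeta ranges over the range of A^T. *)
Definition RSP_tr (k : nat) : Prop :=
  forall S1 S2 : {set 'I_n}, [disjoint S1 & S2] -> (#|S1| + #|S2| <= k)%N ->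
  exists2 zeta : 'cV[R]_n, (exists v : 'cV[R]_m, zeta = A^T *m v) &
    [/\ forall i, i \in S1 -> zeta i 0 = 1,
        forall i, i \in S2 -> zeta i 0 = -1
      & forall i, i \notin (S1 :|: S2) -> `|zeta i 0| < 1].

End MatrixConditions.

Section Robinson.
Variable R : realType.
(* The norms alpha_1 and alpha_2, given uniformly in the dimension. *)
Variables nu1 nu2 : forall p, 'cV[R]_p -> R.

Definition polysys p1 p2 r (M' : 'M[R]_(p1, r)) (M'' : 'M[R]_(p2, r))
    (d' : 'cV[R]_p1) (d'' : 'cV[R]_p2) : set 'cV[R]_r :=
  [set u | (forall i, (M' *m u) i 0 <= d' i 0) /\ M'' *m u = d'']%classic.

Definition robinson_mu p1 p2 r (M' : 'M[R]_(p1, r)) (M'' : 'M[R]_(p2, r)) : R :=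
  sup [set inf [set nu1 u | u in polysys M' M'' d.1 d.2]
      | d in [set d : 'cV[R]_p1 * 'cV[R]_p2 |
              (exists u, polysys M' M'' d.1 d.2 u)
              /\ nu2 (col_mx d.1 d.2) <= 1]]%classic.

Definition robinson_sigma m1 m2 l (N1 : 'M[R]_(m1, l)) (N2 : 'M[R]_(m2, l)) : R :=
  \big[Num.max/0]_(S : {set 'I_m1})
    robinson_mu
      (block_mx (rowsub (@enum_val _ (mem S)) 1%:M) (0 : 'M_(#|S|, m2))
                (- 1%:M : 'M_m1)                    (0 : 'M_(m1, m2)))
      (col_mx N1 N2)^T.

End Robinson.

Section Problem.
Variables (R : realType) (m n q : nat).
Variables (A : 'M[R]_(m, n)) (M : 'M[R]_(m, q)).
Variables (y : 'cV[R]_m) (tau alpha : R).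

Definition theta (x : 'cV[R]_n) : 'cV[R]_q := M^T *m (A *m x - y).

Definition P_constraint (x : 'cV[R]_n) : R :=
  alpha * linfnorm (theta x) + (1 - alpha) * l1norm (theta x).

Definition P_feasible (x : 'cV[R]_n) : Prop := P_constraint x <= tau.

Definition P_optimal (x : 'cV[R]_n) : Prop :=
  P_feasible x /\ forall z, P_feasible z -> l1norm x <= l1norm z.

(* M_G, for #|G| = m; [conform_mx] only adjusts the type 'M_(m, #|G|) of the
   column submatrix to 'M_m, and returns 0 when #|G| <> m. *)
Definition msub (G : {set 'I_q}) : 'M[R]_m :=
  conform_mx 0 (colsub (@enum_val _ (mem G)) M).

Definition const_c : R :=
  \big[Num.max/0]_(G : {set 'I_q} | (#|G| == m) && (msub G \in unitmx))
    norm_infty_to_1 (invmx (msub G) *m invmx (A *m A^T) *m A).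

Definition blockrow p (B1 : 'M[R]_(p, n)) (B2 : 'M[R]_(p, n))
    (B3 : 'M[R]_(p, 1)) (B4 : 'M[R]_(p, q)) (B5 : 'M[R]_(p, n))
    (B6 : 'M[R]_(p, n)) (B7 : 'M[R]_(p, 1)) (B8 : 'M[R]_(p, q))
    (B9 : 'M[R]_(p, q)) (B10 : 'M[R]_(p, q)) (B11 : 'M[R]_(p, q)) :=
  row_mx B1 (row_mx B2 (row_mx B3 (row_mx B4 (row_mx B5 (row_mx B6
    (row_mx B7 (row_mx B8 (row_mx B9 (row_mx B10 B11))))))))).

Let I {k} : 'M[R]_k := 1%:M.
Let e : 'cV[R]_q := const_mx 1.
Let et : 'cV[R]_n := const_mx 1.
Let MA : 'M[R]_(q, n) := M^T *m A.
Let AM : 'M[R]_(n, q) := A^T *m M.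
Let yM : 'M[R]_(1, q) := y^T *m M.
Let a : 'M[R]_1 := alpha%:M.

Definition matM1 :=
  col_mx (blockrow   I    (- I)    0        0               0     0     0                   0     0     0     0)
 (col_mx (blockrow (- I)  (- I)    0        0               0     0     0                   0     0     0     0)
 (col_mx (blockrow   0      0      a   ((1 - alpha) *: e^T) 0     0     0                   0     0     0     0)
 (col_mx (blockrow   MA     0    (- e)      0               0     0     0                   0     0     0     0)
 (col_mx (blockrow (- MA)   0    (- e)      0               0     0     0                   0     0     0     0)
 (col_mx (blockrow   MA     0      0      (- I)             0     0     0                   0     0     0     0)
 (col_mx (blockrow (- MA)   0      0      (- I)             0     0     0                   0     0     0     0)
 (col_mx (blockrow   0      0      0        0               I     I     0                   0     0     0     0)
 (col_mx (blockrow   0      0      0        0               0     0   (- a)                e^T   e^T    0     0)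
 (col_mx (blockrow   0      0      0        0               0     0   (- (1 - alpha) *: e)  0     0     I     I)
 (col_mx (blockrow   0      0      0        0             (- I)   0     0                   0     0     0     0)
 (col_mx (blockrow   0      0      0        0               0   (- I)   0                   0     0     0     0)
 (col_mx (blockrow   0      0      0        0               0     0   (- I)                 0     0     0     0)
 (col_mx (blockrow   0      0      0        0               0     0     0                 (- I)   0     0     0)
 (col_mx (blockrow   0      0      0        0               0     0     0                   0   (- I)   0     0)
 (col_mx (blockrow   0      0      0        0               0     0     0                   0     0   (- I)   0)
         (blockrow   0      0      0        0               0     0     0                   0     0     0   (- I))
 ))))))))))))))).

Definition matM2 :=
  col_mx (blockrow   0      0      0        0             (- I)   I     0                   AM  (- AM) (- AM) AM)
         (blockrow   0     et^T    0        0               0     0   tau%:M              (- yM)  yM     yM (- yM)).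

End Problem.

Definition robinson_gamma (R : realType) (m n q : nat) (A : 'M[R]_(m, n))
    (M : 'M[R]_(m, q)) (y : 'cV[R]_m) (tau alpha : R) : R :=
  robinson_sigma (@linfnorm R) (@l2norm R) (matM1 A M alpha) (matM2 A M y tau).

(* Main.v *)
Require Import Defs.
From HB Require Import structures.
From mathcomp Require Import all_boot all_order all_algebra.
From mathcomp Require Import classical_sets reals matrix_normedtype normed_module.
From mathcomp Require Import boolp topology function_spaces.
From mathcomp Require Import pseudometric_normed_Zmodule num_normedtype derive.
From mathcomp Require Import ring lra.

Set Implicit Arguments.
Unset Strict Implicit.
Unset Printing Implicit Defensive.

Import Order.TTheory GRing.Theory Num.Theory.
Import numFieldNormedType.Exports.
Local Open Scope ring_scope.

(** The pairs (primal solution, dual solution) of the linear program equivalent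
    to (P) form the polyhedron [M1 z <= b, M2 z = 0]. Robinson's error bound
    places a point of this polyhedron within [gamma] times the [l1]-norm of the
    residual of any [z]: if [zs] is the point nearest to [z], then [z - zs] lies
    in the normal cone at [zs], and [gamma] bounds the multipliers representing
    its direction. Each of the conditions (a)-(e) yields the null space
    property with a weak inequality, which by Farkas' lemma yields, as does (f),
    a vector [A^T v] with entries in [-1, 1] that equals the sign of [x] at its
    [k] largest entries. Writing [v = M h] with [h] supported on an invertible
    submatrix, so that its [l1]-norm is at most [c], one extends [x] to a point
    [z] whose residual consists of the constraint violation of [x] and of a
    duality gap, which is at most [2 sigma_k(x)_1 + c (tau + |theta|_oo)]. *)

(** * Systems of linear inequalities *)

Section Elimination.
Variable R : realFieldType.

(** [gamma] is a supremum, so it bounds anything only once the multipliers are known to be bounded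
    uniformly over right-hand sides of norm at most 1. Farkas' lemma alone does not give that; hence
    a quantitative Fourier-Motzkin elimination, whose constant depends on the matrices alone. The
    same elimination yields Farkas' lemma, applied three times: to the normal cone at the nearest
    point, to the vector [A^T v], and to the polyhedron itself, whose nonemptiness is strong duality
    because the last row of [M2] sets the duality gap to zero. In Robinson's constant the rows
    [I_S u <= 0] and [- u <= 0] force the multipliers of the inequalities to be nonnegative and to
    vanish on [S]. This is complementary slackness, with [S] the set of inactive constraints at the
    nearest point; the maximum over all [S] covers every possible such set. The norms are oo and 2
    because the multipliers are paired with a residual in the l1-norm, while their combination is a
    Euclidean unit vector. *)

Lemma sum_delta (I : finType) (i : I) (x : R) (f : I -> R) :
  \sum_i' (if i' == i then x else 0) * f i' = x * f i.
Proof.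
rewrite (bigD1 i)//= eqxx big1 ?addr0// => j /negPf ->.
by rewrite mul0r.
Qed.

Lemma le_sum_term (I : finType) (f : I -> R) i :
  (forall j, 0 <= f j) -> f i <= \sum_j f j.
Proof. by move=> f0; rewrite (bigD1 i)//= lerDl sumr_ge0. Qed.

Lemma arg_min_exists (I : finType) (P : pred I) (f : I -> R) i0 : P i0 ->
  exists2 i, P i & forall j, P j -> f i <= f j.
Proof.
by move=> Pi0; case: (arg_minP f Pi0) => i Pi le_i; exists i.
Qed.

(** One Fourier-Motzkin step: the unknown lies below [g i / c i] when [c i > 0] and above it when
    [c i < 0], and the pairwise combinations say that no lower bound exceeds an upper one. The value
    [s] is itself one of these bounds, or 0, whence the constant [C]. *)
Lemma eliminate1 (I : finType) (c : I -> R) :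
  exists (J : finType) (T : J -> I -> R) (C : R),
    [/\ forall j i, 0 <= T j i, forall j, \sum_i T j i * c i = 0, 0 <= C &
      forall (g : I -> R) (B : R), 0 <= B -> (forall i, `|g i| <= B) ->
      (forall j, 0 <= \sum_i T j i * g i) ->
      exists2 s, forall i, c i * s <= g i & `|s| <= C * B].
Proof.
(* Indices with the wrong sign pattern give a zero row, so the index type need not be cut down. *)
pose T (j : I + I * I) (i' : I) : R := match j with
  | inl i => if c i == 0 then (if i' == i then 1 else 0) else 0
  | inr (i, k) => if (0 < c i) && (c k < 0)
      then (if i' == i then - c k else 0) + (if i' == k then c i else 0) else 0
  end.
have TE j f : \sum_i T j i * f i = match j with
  | inl i => if c i == 0 then f i else 0
  | inr (i, k) => if (0 < c i) && (c k < 0) then - c k * f i + c i * f k else 0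
  end.
  case: j => [i|[i k]] /=.
    case: ifP => _; first by rewrite sum_delta mul1r.
    by rewrite big1// => i' _; rewrite mul0r.
  case: ifP => _; last by rewrite big1// => i' _; rewrite mul0r.
  under eq_bigr do rewrite mulrDl.
  by rewrite big_split /= !sum_delta.
have C0 : 0 <= \sum_i `|c i|^-1 by apply: sumr_ge0 => i _; rewrite invr_ge0.
exists _, T, (\sum_i `|c i|^-1); split => //.
- move=> [i|[i k]] i' /=; case: ifP => //; first by case: ifP.
  by move=> /andP[ci ck]; apply: addr_ge0; case: ifP => // _; lra.
- move=> j; rewrite TE; case: j => [i|[i k]]; case: ifP => //; first by move/eqP.
  by move=> _; ring.
move=> g B B0 gB gT.
have bnd i : `|g i / c i| <= (\sum_i `|c i|^-1) * B.
  rewrite normrM normfV mulrC ler_pM ?invr_ge0 ?normr_ge0 ?gB//.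
  by apply: (le_sum_term (f := fun i => `|c i|^-1)) => j; rewrite invr_ge0.
have eq0 k : c k = 0 -> 0 <= g k.
  by move=> ck; have := gT (inl k); rewrite TE ck eqxx.
have cross i k : 0 < c i -> c k < 0 -> 0 <= - c k * g i + c i * g k.
  by move=> ci ck; have := gT (inr (i, k)); rewrite TE ci ck.
have [i0 ci0|nopos] := pickP (fun i => 0 < c i).
  have [i ci imin] :=
    @arg_min_exists _ (fun i => 0 < c i) (fun i => g i / c i) _ ci0.
  exists (g i / c i) => // k; have [ck|ck|ck] := ltgtP (c k) 0.
  - by have := cross _ _ ci ck; rewrite mulrA ler_pdivrMr//; lra.
  - by rewrite mulrC -ler_pdivlMr// imin.
  - by rewrite ck mul0r eq0.
have [i0 ci0|noneg] := pickP (fun i => c i < 0).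
  have [i ci imin] :=
    @arg_min_exists _ (fun i => c i < 0) (fun i => - (g i / c i)) _ ci0.
  exists (g i / c i) => // k; have [ck|ck|ck] := ltgtP (c k) 0.
  - by have := imin _ ck; rewrite lerN2 ler_ndivrMr// [_ * c k]mulrC.
  - by have := nopos k; rewrite ck.
  - by rewrite ck mul0r eq0.
exists 0; last by rewrite normr0 mulr_ge0.
move=> k; rewrite mulr0 eq0//.
by have := nopos k; have := noneg k; case: ltgtP.
Qed.

(* Fourier-Motzkin elimination of all variables. The rows of [T] depend on the
   left-hand sides [a] only, so the same construction yields Farkas' lemma and
   a bound on solutions that is uniform in the right-hand side [b]. *)
Lemma eliminate r (I : finType) (a : I -> 'I_r -> R) :
  exists (J : finType) (T : J -> I -> R) (C : R),
    [/\ forall j i, 0 <= T j i, forall j l, \sum_i T j i * a i l = 0, 0 <= C &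
      forall (b : I -> R) (B : R), 0 <= B -> (forall i, `|b i| <= B) ->
      (forall j, 0 <= \sum_i T j i * b i) ->
      exists2 u : 'I_r -> R, forall i, \sum_l a i l * u l <= b i &
        forall l, `|u l| <= C * B].
Proof.
elim: r I a => [|r IH] I a.
  exists I, (fun j i => if i == j then 1 else 0), 0; split => //.
  - by move=> j i; case: ifP.
  - by move=> j [].
  move=> b B B0 bB bT; exists (fun=> 0); last by case.
  by move=> i; rewrite big_ord0; have := bT i; rewrite sum_delta mul1r.
have [J1 [T1 [C1 [T1p T1c C1p H1]]]] := eliminate1 (fun i => a i ord0).
pose a' j l := \sum_i T1 j i * a i (lift ord0 l).
have [J2 [T2 [C2 [T2p T2c C2p H2]]]] := IH J1 a'.
pose D := \sum_j \sum_i T1 j i.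
pose K := \sum_i \sum_l `|a i (lift ord0 l)|.
have sumT2 f j2 : \sum_i (\sum_j T2 j2 j * T1 j i) * f i =
                   \sum_j T2 j2 j * \sum_i T1 j i * f i.
  under eq_bigr do rewrite mulr_suml.
  rewrite exchange_big /=; apply: eq_bigr => j _.
  by rewrite mulr_sumr; apply: eq_bigr => i _; rewrite mulrA.
have D0 : 0 <= D by apply: sumr_ge0 => j _; apply: sumr_ge0.
have K0 : 0 <= K by apply: sumr_ge0 => j _; apply: sumr_ge0.
(* The eliminated right-hand sides are at most [D * B], so [u'] is at most [C2 * (D * B)]. The first
   summand bounds the variable recovered by back substitution, the second the entries of [u']. *)
exists J2, (fun j2 i => \sum_j T2 j2 j * T1 j i),
  (C1 * (1 + K * (C2 * D)) + C2 * D).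
have C1D : 0 <= C1 * (1 + K * (C2 * D)) by rewrite mulr_ge0 ?addr_ge0 ?mulr_ge0.
split.
- by move=> j i; apply: sumr_ge0 => j1 _; apply: mulr_ge0.
- move=> j l; rewrite sumT2; have [l'|] := unliftP ord0 l => [] ->.
    exact: T2c.
  by rewrite big1// => j1 _; rewrite T1c mulr0.
- by rewrite addr_ge0// mulr_ge0.
move=> b B B0 bB bT.
have bB' j : `|\sum_i T1 j i * b i| <= D * B.
  apply: le_trans (ler_norm_sum _ _ _) _.
  apply: (@le_trans _ _ ((\sum_i T1 j i) * B)).
    rewrite mulr_suml.
    by apply: ler_sum => i _; rewrite normrM (ger0_norm (T1p _ _)) ler_wpM2l.
  rewrite ler_wpM2r//.
  by apply: (le_sum_term (f := fun j => \sum_i T1 j i)) => j'; apply: sumr_ge0.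
have [||u' u'a u'B] := H2 _ _ _ bB'; first by rewrite mulr_ge0.
  by move=> j; rewrite -sumT2.
pose g i := b i - \sum_l a i (lift ord0 l) * u' l.
have [|||s sg sB] := H1 g (B + K * (C2 * (D * B))).
- by rewrite addr_ge0 ?mulr_ge0.
- move=> i; apply: le_trans (ler_normB _ _) _; apply: lerD => //.
  apply: le_trans (ler_norm_sum _ _ _) _.
  apply: (@le_trans _ _ ((\sum_l `|a i (lift ord0 l)|) * (C2 * (D * B)))).
    rewrite mulr_suml; apply: ler_sum => l _.
    by rewrite normrM ler_wpM2l.
  rewrite ler_wpM2r ?mulr_ge0//.
  apply: (le_sum_term (f := fun i => \sum_l `|a i (lift ord0 l)|)) => j.
  exact: sumr_ge0.
- move=> j; have := u'a j; rewrite -subr_ge0 => /le_trans; apply.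
  rewrite le_eqVlt; apply/orP; left; apply/eqP.
  under [RHS]eq_bigr do rewrite mulrBr.
  rewrite sumrB; congr (_ - _).
  under eq_bigr do rewrite mulr_suml.
  rewrite exchange_big /=; apply: eq_bigr => i _.
  by rewrite mulr_sumr; apply: eq_bigr => l _; rewrite mulrA.
exists (fun l => if unlift ord0 l is Some l' then u' l' else s).
  move=> i; rewrite big_ord_recl unlift_none.
  under eq_bigr do rewrite liftK.
  by have := sg i; rewrite /g lerBrDr.
move=> l; case: unliftP => [l' _|_].
  by apply: le_trans (u'B l') _; rewrite mulrA mulrDl lerDr mulr_ge0.
apply: le_trans sB _; rewrite mulrDl -[leLHS]addr0.
by rewrite lerD ?mulr_ge0// le_eqVlt; apply/orP; left; apply/eqP; ring.
Qed.

End Elimination.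

(** * Farkas' lemma and Hoffman's bound *)

Section Farkas.
Variable R : realType.

Definition dot n (u v : 'cV[R]_n) : R := \sum_i u i 0 * v i 0.

Lemma dotC n (u v : 'cV[R]_n) : dot u v = dot v u.
Proof. by apply: eq_bigr => i _; rewrite mulrC. Qed.

Lemma dotDr n (u v w : 'cV[R]_n) : dot u (v + w) = dot u v + dot u w.
Proof. by rewrite /dot -big_split; apply: eq_bigr => i _; rewrite mxE mulrDr. Qed.

Lemma dotZr n a (u v : 'cV[R]_n) : dot u (a *: v) = a * dot u v.
Proof. by rewrite /dot mulr_sumr; apply: eq_bigr => i _; rewrite mxE mulrCA. Qed.

Lemma dotNr n (u v : 'cV[R]_n) : dot u (- v) = - dot u v.
Proof. by rewrite -scaleN1r dotZr mulN1r. Qed.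

Lemma dotBr n (u v w : 'cV[R]_n) : dot u (v - w) = dot u v - dot u w.
Proof. by rewrite dotDr dotNr. Qed.

Lemma dot0r n (u : 'cV[R]_n) : dot u 0 = 0.
Proof. by rewrite -(scale0r 0) dotZr mul0r. Qed.

Lemma dotDl n (u v w : 'cV[R]_n) : dot (u + v) w = dot u w + dot v w.
Proof. by rewrite !(dotC _ w) dotDr. Qed.

Lemma dotZl n a (u v : 'cV[R]_n) : dot (a *: u) v = a * dot u v.
Proof. by rewrite !(dotC _ v) dotZr. Qed.

Lemma dotNl n (u v : 'cV[R]_n) : dot (- u) v = - dot u v.
Proof. by rewrite !(dotC _ v) dotNr. Qed.

Lemma dotBl n (u v w : 'cV[R]_n) : dot (u - v) w = dot u w - dot v w.
Proof. by rewrite dotDl dotNl. Qed.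

Lemma dot0l n (u : 'cV[R]_n) : dot 0 u = 0.
Proof. by rewrite dotC dot0r. Qed.

Lemma dotE n (u v : 'cV[R]_n) : dot u v = (u^T *m v) 0 0.
Proof. by rewrite mxE; apply: eq_bigr => i _; rewrite mxE. Qed.

Lemma dot_mulmxl p n (Q : 'M[R]_(p, n)) (u : 'cV[R]_n) (v : 'cV[R]_p) :
  dot (Q *m u) v = dot u (Q^T *m v).
Proof. by rewrite !dotE trmx_mul mulmxA. Qed.

Lemma dot_mulmxr p n (Q : 'M[R]_(p, n)) (u : 'cV[R]_p) (v : 'cV[R]_n) :
  dot u (Q *m v) = dot (Q^T *m u) v.
Proof. by rewrite dotC dot_mulmxl dotC. Qed.

Lemma dot_col p n (u u' : 'cV[R]_p) (v v' : 'cV[R]_n) :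
  dot (col_mx u v) (col_mx u' v') = dot u u' + dot v v'.
Proof.
rewrite /dot big_split_ord /=; congr (_ + _); apply: eq_bigr => i _.
  by rewrite !col_mxEu.
by rewrite !col_mxEd.
Qed.

Lemma dot_ge0 n (u : 'cV[R]_n) : 0 <= dot u u.
Proof. by apply: sumr_ge0 => i _; rewrite -expr2 sqr_ge0. Qed.

Lemma dot_eq0 n (u : 'cV[R]_n) : dot u u = 0 -> u = 0.
Proof.
move=> /eqP; rewrite psumr_eq0 => [/allP u0|i _]; last by rewrite -expr2 sqr_ge0.
apply/colP => i; have := u0 i; rewrite mem_index_enum => /(_ isT) /=.
by rewrite mulf_eq0 orbb mxE => /eqP.
Qed.

Lemma l1norm_ge0 n (u : 'cV[R]_n) : 0 <= l1norm u.
Proof. exact: sumr_ge0. Qed.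

Lemma le_l1norm n (u : 'cV[R]_n) i : `|u i 0| <= l1norm u.
Proof. by apply: (le_sum_term (f := fun i => `|u i 0|)). Qed.

(** Each equation enters as two opposite inequalities, so its multiplier is a difference of
    nonnegative numbers and has no sign. The constant is fixed before the right-hand sides. *)
Lemma polysys_dichotomy p1 p2 r (M' : 'M[R]_(p1, r)) (M'' : 'M[R]_(p2, r)) :
  exists2 C : R, 0 <= C & forall (d' : 'cV_p1) (d'' : 'cV_p2) (B : R), 0 <= B ->
    (forall i, `|d' i 0| <= B) -> (forall i, `|d'' i 0| <= B) ->
    (exists2 u, polysys M' M'' d' d'' u & forall l, `|u l 0| <= C * B)
    \/ (exists (p : 'cV[R]_p1) (s : 'cV[R]_p2),
        [/\ forall i, 0 <= p i 0, M'^T *m p + M''^T *m s = 0 &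
          dot p d' + dot s d'' < 0]).
Proof.
pose a (i : 'I_p1 + ('I_p2 + 'I_p2)) (l : 'I_r) : R := match i with
  | inl i => M' i l | inr (inl i) => M'' i l | inr (inr i) => - M'' i l end.
have [J [T [C [T0 Ta C0 H]]]] := eliminate a.
exists C => // d' d'' B B0 d'B d''B.
pose b (i : 'I_p1 + ('I_p2 + 'I_p2)) : R := match i with
  | inl i => d' i 0 | inr (inl i) => d'' i 0 | inr (inr i) => - d'' i 0 end.
have bB i : `|b i| <= B by case: i => [i|[i|i]] //=; rewrite normrN.
case: (pickP (fun j => \sum_i T j i * b i < 0)) => [j Tj|Tb]; [right|left].
  exists (\col_i T j (inl i)), (\col_i (T j (inr (inl i)) - T j (inr (inr i)))).
  split; first by move=> i; rewrite mxE.
    apply/colP => l; rewrite !mxE -[RHS](Ta j l) !big_sumType /=; congr (_ + _).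
      by apply: eq_bigr => i _; rewrite !mxE mulrC.
    rewrite -big_split /=; apply: eq_bigr => i _.
    by rewrite !mxE; ring.
  move: Tj; rewrite !big_sumType /= -big_split /=; congr (_ + _ < 0).
    by apply: eq_bigr => i _; rewrite mxE.
  by apply: eq_bigr => i _; rewrite mxE; ring.
have [|u ua uB] := H b B B0 bB; first by move=> j; rewrite leNgt; have /= -> := Tb j.
have sumE p (N : 'M[R]_(p, r)) i : (N *m (\col_l u l)) i 0 = \sum_l N i l * u l.
  by rewrite mxE; apply: eq_bigr => l _; rewrite mxE.
exists (\col_l u l); last by move=> l; rewrite mxE.
split; first by move=> i; rewrite sumE; exact: ua (inl i).
apply/colP => i; rewrite sumE; apply/eqP; rewrite eq_le (ua (inr (inl i))) /=.
have := ua (inr (inr i)); rewrite /=.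
by under eq_bigr do rewrite mulNr; rewrite sumrN lerN2.
Qed.

(** Feasibility excludes the certificate: paired with a solution [u], the certificate gives a value
    that is at least 0. *)
Lemma hoffman_bound p1 p2 r (M' : 'M[R]_(p1, r)) (M'' : 'M[R]_(p2, r)) :
  exists2 C : R, 0 <= C & forall (d' : 'cV_p1) (d'' : 'cV_p2) (B : R), 0 <= B ->
    (forall i, `|d' i 0| <= B) -> (forall i, `|d'' i 0| <= B) ->
    (exists u, polysys M' M'' d' d'' u) ->
    exists2 u, polysys M' M'' d' d'' u & forall l, `|u l 0| <= C * B.
Proof.
have [C C0 H] := polysys_dichotomy M' M''; exists C => // d' d'' B B0 d'B d''B.
move=> [u [u1 u2]]; case: (H _ _ _ B0 d'B d''B) => // -[p [s [p0 ps0]]].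
suff : 0 <= dot p d' + dot s d'' by move=> /le_lt_trans/[apply]; rewrite ltxx.
have <- : dot (M'^T *m p + M''^T *m s) u = 0 by rewrite ps0 dot0l.
rewrite dotDl !dot_mulmxl !trmxK u2 lerD2r; apply: ler_sum => i _.
by rewrite ler_wpM2l.
Qed.

Lemma farkas p1 p2 r (M' : 'M[R]_(p1, r)) (M'' : 'M[R]_(p2, r)) d' d'' :
  (exists u, polysys M' M'' d' d'' u)
  \/ (exists (p : 'cV[R]_p1) (s : 'cV[R]_p2),
        [/\ forall i, 0 <= p i 0, M'^T *m p + M''^T *m s = 0 &
        dot p d' + dot s d'' < 0]).
Proof.
have [C _ H] := polysys_dichotomy M' M''.
have [| | |[u uP _]|] := H d' d'' (l1norm d' + l1norm d''); last by right.
- by rewrite addr_ge0 ?l1norm_ge0.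
- by move=> i; rewrite (le_trans (le_l1norm _ _)) ?lerDl ?l1norm_ge0.
- by move=> i; rewrite (le_trans (le_l1norm _ _)) ?lerDr ?l1norm_ge0.
- by left; exists u.
Qed.

End Farkas.

(** * Robinson's error bound *)

Section Minimizers.
Variable R : realType.

Lemma mx_norm_le p n (u : 'M[R]_(p, n)) B :
  0 <= B -> (forall i j, `|u i j| <= B) -> `|u| <= B.
Proof.
move=> B0 uB; rewrite /Num.norm/= mx_normrE; apply/bigmax_leP; split=> [|[i j] _] //=.
Qed.

Lemma le_mx_norm p n (u : 'M[R]_(p, n)) i j : `|u i j| <= `|u|.
Proof.
rewrite [leRHS]/Num.norm/= mx_normrE.
exact: (@le_bigmax _ _ _ 0 (fun ij => `|u ij.1 ij.2|) (i, j)).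
Qed.

Lemma continuous_sum_ord (T : topologicalType) (I : finType) (F : I -> T -> R) :
  (forall i, continuous (F i)) -> continuous (fun x => \sum_i F i x).
Proof. by move=> Fc; apply: continuous_big => //; exact: add_continuous. Qed.

Lemma continuous_subr (T : topologicalType) (f g : T -> R) :
  continuous f -> continuous g -> continuous (fun x => f x - g x).
Proof. by move=> fc gc x; apply: cvgB; [exact: fc|exact: gc]. Qed.

Lemma continuous_mulr (T : topologicalType) (f g : T -> R) :
  continuous f -> continuous g -> continuous (fun x => f x * g x).
Proof. by move=> fc gc x; apply: cvgM; [exact: fc|exact: gc]. Qed.

Lemma continuous_mulmx_coord p n (Q : 'M[R]_(p, n)) (b : 'cV[R]_p) i :
  continuous (fun v : 'rV[R]_n => (Q *m v^T - b) i 0).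
Proof.
have -> : (fun v : 'rV[R]_n => (Q *m v^T - b) i 0)
  = (fun v => (\sum_j Q i j * v 0 j) - b i 0).
  apply/funext => v; rewrite !mxE; congr (_ - _).
  by apply: eq_bigr => j _; rewrite mxE.
apply: continuous_subr; last exact: cst_continuous.
apply: continuous_sum_ord => j.
by apply: continuous_mulr; [exact: cst_continuous|exact: coord_continuous].
Qed.

(** The coordinate bound [f v + K] makes sublevel sets of [f] bounded, so the feasible part of the
    sublevel set through a feasible point is compact. *)
Lemma coercive_min n (I : Type) (g : I -> 'rV[R]_n -> R)
    (f : 'rV[R]_n -> R) (K : R) :
  (exists v, forall i, g i v <= 0) ->
  (forall i, continuous (g i)) -> continuous f ->
  (forall (v : 'rV[R]_n) j, `|v 0 j| <= f v + K) ->
  exists2 c, forall i, g i c <= 0 &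
    forall v, (forall i, g i v <= 0) -> f c <= f v.
Proof.
move=> [v0 v0g] gc fc fK.
pose A := [set v | forall i, g i v <= 0]%classic.
pose A0 := (A `&` f @^-1` [set x | x <= f v0])%classic.
have A00 : (A0 !=set0)%classic by exists v0; split => //=.
have A0c : compact A0.
  apply: bounded_closed_compact.
    exists (Num.max 0 (f v0 + K)); split; first exact: num_real.
    move=> x; rewrite gt_max => /andP[x0 xK] v [_ /= vf].
    apply: mx_norm_le => [|i j]; first exact: ltW.
    rewrite ord1; apply: le_trans (fK _ _) _.
    by apply: le_trans (ltW xK); rewrite lerD2r.
  apply: closedI.
    have -> : A = (\bigcap_(i in setT) (g i @^-1` [set x | x <= 0]))%classic.
      by apply/seteqP; split => v /= vA i //; [move=> _|]; exact: vA.
    apply: closed_bigI => i _; apply: closed_comp; last exact: closed_le.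
    by move=> v _; exact: gc.
  apply: closed_comp; last exact: closed_le.
  by move=> v _; exact: fc.
have [c cA cmin] := EVT_min_rV A00 A0c (continuous_subspaceT fc).
move: cA; rewrite inE => -[cA cf]; exists c => // v vA.
have [vf|/ltW vf] := leP (f v) (f v0); last exact: le_trans vf.
by apply: cmin; rewrite inE; split.
Qed.

Lemma l2norm_sqr n (u : 'cV[R]_n) : l2norm u ^+ 2 = dot u u.
Proof.
rewrite sqr_sqrtr; last by apply: sumr_ge0 => i _; exact: sqr_ge0.
by apply: eq_bigr => i _; rewrite expr2.
Qed.

Lemma l2norm_ge0 n (u : 'cV[R]_n) : 0 <= l2norm u.
Proof. exact: sqrtr_ge0. Qed.

Lemma nearest_point m1 m2 l (N1 : 'M[R]_(m1, l)) (N2 : 'M[R]_(m2, l)) b1 b2 z :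
  (exists u, polysys N1 N2 b1 b2 u) ->
  exists2 zs, polysys N1 N2 b1 b2 zs &
    forall u, polysys N1 N2 b1 b2 u -> dot (z - zs) (z - zs) <= dot (z - u) (z - u).
Proof.
move=> [u0 [u01 u02]].
pose g (i : 'I_m1 + ('I_m2 + 'I_m2)) (v : 'rV[R]_l) : R := match i with
  | inl i => (N1 *m v^T - b1) i 0 | inr (inl i) => (N2 *m v^T - b2) i 0
  | inr (inr i) => - (N2 *m v^T - b2) i 0 end.
have gP v : (forall i, g i v <= 0) <-> polysys N1 N2 b1 b2 v^T.
  split=> [gv|[v1 v2] [i|[i|i]] /=].
  - split; first by move=> i; have := gv (inl i); rewrite /= !mxE subr_le0.
    apply/colP => i; apply/eqP; rewrite eq_le.
    have := gv (inr (inl i)); have := gv (inr (inr i)).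
    by rewrite /= !mxE oppr_le0 subr_le0 subr_ge0 => -> ->.
  - by have := v1 i; rewrite !mxE subr_le0.
  - by rewrite v2 subrr mxE.
  - by rewrite v2 subrr mxE oppr0.
pose f (v : 'rV[R]_l) := dot (z - v^T) (z - v^T).
(* The constant comes from [|v_j| <= |z_j| + |z_j - v_j|] and [|t| <= 1 + t^2]. *)
have [||||c /gP cP cmin] := @coercive_min l _ g f (1 + \sum_i `|z i 0|).
- by exists u0^T; apply/gP; rewrite trmxK.
- move=> [i|[i|i]]; [exact: continuous_mulmx_coord|exact: continuous_mulmx_coord|].
  rewrite /g (_ : (fun _ => _) = fun v => 0 - (N2 *m v^T - b2) i 0); last first.
    by apply/funext => v; rewrite sub0r.
  by apply: continuous_subr; [exact: cst_continuous|exact: continuous_mulmx_coord].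
- have cz i : continuous (fun v : 'rV[R]_l => (z - v^T) i 0).
    rewrite (_ : (fun _ => _) = fun v : 'rV[R]_l => z i 0 - v 0 i); last first.
      by apply/funext => v; rewrite !mxE.
    by apply: continuous_subr; [exact: cst_continuous|exact: coord_continuous].
  by apply: continuous_sum_ord => i; exact: continuous_mulr.
- move=> v j.
  have : (z j 0 - v 0 j) ^+ 2 <= f v.
    have := @le_sum_term _ _ (fun i => (z - v^T) i 0 * (z - v^T) i 0) j.
    by rewrite !mxE -expr2; apply => i; rewrite -expr2 sqr_ge0.
  have := @le_sum_term _ _ (fun i => `|z i 0|) j (fun=> normr_ge0 _).
  have := ler_normB (z j 0) (z j 0 - v 0 j); rewrite opprB addrC subrK.
  have : `|z j 0 - v 0 j| <= 1 + (z j 0 - v 0 j) ^+ 2.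
    set t := z j 0 - v 0 j; have := sqr_ge0 (`|t| - 1).
    by rewrite sqrrB real_normK ?num_real//; have := normr_ge0 t; lra.
  by lra.
exists c^T => // u uP; have := cmin u^T; rewrite /f trmxK; apply.
by apply/gP; rewrite trmxK.
Qed.

End Minimizers.

(** * Multipliers at the nearest point *)

Section Robinson.
Variable R : realType.

Notation mu := (robinson_mu (@linfnorm R) (@l2norm R)).
Notation sigma := (robinson_sigma (@linfnorm R) (@l2norm R)).

Lemma linfnorm_le n (u : 'cV[R]_n) B :
  0 <= B -> (forall i, `|u i 0| <= B) -> linfnorm u <= B.
Proof. by move=> B0 uB; apply: mx_norm_le => // i j; rewrite ord1. Qed.

Lemma le_linfnorm n (u : 'cV[R]_n) i : `|u i 0| <= linfnorm u.
Proof. exact: le_mx_norm. Qed.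

Lemma linfnorm_ge0 n (u : 'cV[R]_n) : 0 <= linfnorm u.
Proof. exact: normr_ge0. Qed.

Lemma le_l2norm n (u : 'cV[R]_n) i : `|u i 0| <= l2norm u.
Proof.
rewrite -sqrtr_sqr ler_wsqrtr//.
by apply: (le_sum_term (f := fun i => u i 0 ^+ 2)) => j; rewrite sqr_ge0.
Qed.

(* Hoffman's bound makes the supremum defining [robinson_mu] finite. *)
Lemma robinson_mu_solution p1 p2 r (M' : 'M[R]_(p1, r)) (M'' : 'M[R]_(p2, r))
    d' d'' eps : 0 < eps -> (exists u, polysys M' M'' d' d'' u) ->
  l2norm (col_mx d' d'') <= 1 ->
  exists2 u, polysys M' M'' d' d'' u & linfnorm u < mu M' M'' + eps.
Proof.
move=> eps0 [u0 u0P] d1; have [C C0 hoffman] := hoffman_bound M' M''.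
have lb0 (E' : 'cV_p1) (E'' : 'cV_p2) :
    lbound [set linfnorm u | u in polysys M' M'' E' E'']%classic 0.
  by move=> _ [u _ <-]; exact: linfnorm_ge0.
have [_ [u uP <-] ult] : exists2 e,
    [set linfnorm u | u in polysys M' M'' d' d'']%classic e &
    e < inf [set linfnorm u | u in polysys M' M'' d' d'']%classic + eps.
  apply: inf_adherent => //; split; first by exists (linfnorm u0), u0.
  by exists 0; exact: lb0.
exists u => //; apply: lt_le_trans ult _; rewrite lerD2r.
apply: ub_le_sup; last by exists (d', d'') => //; split => //; exists u0.
exists C => _ [[e' e''] /= [feas e1] <-].
have eB i : `|col_mx e' e'' i 0| <= 1 by apply: le_trans e1; exact: le_l2norm.
have [| | |//|v vP vC] := hoffman e' e'' 1; first exact: ler01.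
- by move=> i; have := eB (lshift _ i); rewrite col_mxEu.
- by move=> i; have := eB (rshift _ i); rewrite col_mxEd.
apply: (@le_trans _ _ (linfnorm v)); last first.
  by rewrite -[C]mulr1 linfnorm_le// mulr1.
by apply: ge_inf; [exists 0; exact: lb0|exists v].
Qed.

Lemma robinson_sigma_ge0 m1 m2 l (N1 : 'M[R]_(m1, l)) (N2 : 'M[R]_(m2, l)) :
  0 <= sigma N1 N2.
Proof. exact: bigmax_ge_id. Qed.

Lemma l2norm_col0 p n (v : 'cV[R]_n) :
  l2norm (col_mx (0 : 'cV_p) v) = l2norm v.
Proof.
rewrite /l2norm big_split_ord /= big1 ?add0r => [|i _]; last first.
  by rewrite col_mxEu mxE expr0n.
by congr Num.sqrt; apply: eq_bigr => i _; rewrite col_mxEd.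
Qed.

Lemma l2normZ n a (v : 'cV[R]_n) : l2norm (a *: v) = `|a| * l2norm v.
Proof.
rewrite /l2norm -sqrtr_sqr -sqrtrM ?sqr_ge0// mulr_sumr.
by congr Num.sqrt; apply: eq_bigr => i _; rewrite mxE exprMn.
Qed.

Lemma rowsub1E m1 (S : {set 'I_m1}) (u : 'cV[R]_m1) j :
  (rowsub (@enum_val _ (mem S)) 1%:M *m u) j 0 = u (enum_val j) 0.
Proof. by rewrite -rowsubE mxE. Qed.

Lemma dot_subZ n (u v : 'cV[R]_n) (a : R) :
  dot (u - a *: v) (u - a *: v) = dot u u - a * (2 * dot u v - a * dot v v).
Proof. by rewrite !(dotBr, dotBl, dotZr, dotZl) (dotC v u); ring. Qed.

(* A direction [d] with [dot (z - zs) d > 0] that keeps the inactive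
   constraints slack would lead to a point closer to [z]. *)
Lemma normal_cone m1 m2 l (N1 : 'M[R]_(m1, l)) (N2 : 'M[R]_(m2, l))
    (b1 : 'cV[R]_m1) (b2 : 'cV[R]_m2) (z zs : 'cV[R]_l)
    (S := [set i | (N1 *m zs) i 0 < b1 i 0]) :
  polysys N1 N2 b1 b2 zs ->
  (forall u, polysys N1 N2 b1 b2 u -> dot (z - zs) (z - zs) <= dot (z - u) (z - u)) ->
  exists u, polysys (block_mx (rowsub (@enum_val _ (mem S)) 1%:M) (0 : 'M_(#|S|, m2))
                (- 1%:M : 'M_m1)                    (0 : 'M_(m1, m2)))
      (col_mx N1 N2)^T 0 (z - zs) u.
Proof.
move=> [zs1 zs2] zsmin; set w := z - zs.
set M' := block_mx _ _ _ _.
have [//|[p [s [p0 ps lt0]]]] := farkas M' (col_mx N1 N2)^T 0 w.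
exfalso; move: ps lt0; rewrite trmxK dot0r add0r => ps sw.
(* The certificate read as a direction: [N2 d = 0], [N1 d] is nonpositive at the active constraints,
   and [d] has positive inner product with [w]. *)
pose d := - s.
have dw : 0 < dot w d by rewrite dotNr oppr_gt0 dotC.
have N12s : col_mx (N1 *m d) (N2 *m d) = M'^T *m p.
  by rewrite -mul_col_mx mulmxN; apply/eqP; rewrite eq_sym -addr_eq0 ps.
move: N12s; rewrite -[p]vsubmxK.
set pS := usubmx p; set pI := dsubmx p.
rewrite /M' tr_block_mx mul_block_col !trmx0 !mul0mx addr0 => /eq_col_mx[N1d N2d].
have N1d_le i : i \notin S -> (N1 *m d) i 0 <= 0.
  move=> iS; rewrite N1d mxE linearN /= trmx1 mulNmx mul1mx [X in _ + X]mxE.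
  have -> : ((rowsub (@enum_val _ (mem S)) 1%:M)^T *m pS) i 0 = 0.
    rewrite mxE big1// => j _; rewrite !mxE.
    case: eqP => [jE|_]; last by rewrite mul0r.
    by have := enum_valP j; rewrite jE (negPf iS).
  by rewrite add0r oppr_le0 mxE.
pose D := \sum_i `|(N1 *m d) i 0| / (b1 i 0 - (N1 *m zs) i 0) *+ (i \in S).
have slack i : i \in S -> 0 < b1 i 0 - (N1 *m zs) i 0 by rewrite inE subr_gt0.
have D_term i : 0 <= `|(N1 *m d) i 0| / (b1 i 0 - (N1 *m zs) i 0) *+ (i \in S).
  have [iS|//] := boolP (i \in S).
  by rewrite mulr1n divr_ge0// ltW// slack.
have D0 : 0 <= D by apply: sumr_ge0.
have q0 : 0 <= dot d d / dot w d by rewrite divr_ge0 ?dot_ge0 ?ltW.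
(* [e * D <= 1] keeps the step within the slack of every inactive constraint; the last term gives
   [e * dot d d < 2 * dot w d], that is, a decrease of the distance. *)
pose e := (1 + D + dot d d / dot w d)^-1.
have den0 : 0 < 1 + D + dot d d / dot w d.
  by rewrite !ltr_wpDr.
have e0 : 0 < e by rewrite invr_gt0.
have uP : polysys N1 N2 b1 b2 (zs + e *: d).
  split; last by rewrite mulmxDr -scalemxAr N2d scaler0 addr0.
  move=> i; rewrite mulmxDr -scalemxAr mxE [X in _ + X]mxE.
  have [iS|iS] := boolP (i \in S); last first.
    by rewrite -[leRHS]addr0 lerD ?zs1// pmulr_rle0// N1d_le.
  rewrite -lerBrDl; apply: le_trans (ler_norm _) _.
  rewrite normrM gtr0_norm// mulrC ler_pdivrMr// mulrC -ler_pdivrMr ?slack//.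
  apply: (@le_trans _ _ D); last first.
    by rewrite -addrA addrC -addrA lerDl addr_ge0.
  have := le_sum_term i D_term.
  by rewrite iS.
have := zsmin _ uP; rewrite leNgt => /negP; apply.
rewrite opprD addrA -/w dot_subZ.
have : e * dot d d < 2 * dot w d.
  rewrite -[dot d d](divfK (lt0r_neq0 dw)) mulrA ltr_pM2r//.
  have : 0 <= e * D by rewrite mulr_ge0// ltW.
  have : e * (1 + D + dot d d / dot w d) = 1 by rewrite mulVf// lt0r_neq0.
  by rewrite !mulrDr mulr1; move: e0; lra.
by rewrite -subr_gt0 => h; rewrite gtrBl mulr_gt0.
Qed.

(** If [v] represents the unit direction of [z - zs], then [l2norm (z - zs)] is the pairing of [v]
    with the image of [z - zs]. By complementarity the image of [zs] may be replaced there by the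
    right-hand side, so the distance is at most the maximum norm of [v] times the l1-residual of
    [z]. *)
Theorem robinson_error_bound m1 m2 l (N1 : 'M[R]_(m1, l)) (N2 : 'M[R]_(m2, l))
    b1 b2 z :
  (exists u, polysys N1 N2 b1 b2 u) ->
  exists2 zs, polysys N1 N2 b1 b2 zs &
    l2norm (z - zs) <= sigma N1 N2 *
      (\sum_i Num.max ((N1 *m z - b1) i 0) 0 + l1norm (N2 *m z - b2)).
Proof.
move=> feas; have [zs zsP zsmin] := nearest_point z feas.
exists zs => //; set res := (X in _ * X).
have res0 : 0 <= res.
  by rewrite addr_ge0 ?sumr_ge0// => i _; rewrite le_max lexx orbT.
have [w0|w0] := eqVneq (l2norm (z - zs)) 0.
  by rewrite w0 mulr_ge0// robinson_sigma_ge0.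
have wgt0 : 0 < l2norm (z - zs) by rewrite lt_def w0 l2norm_ge0.
have [u uP] := normal_cone zsP zsmin; move: uP.
set S := [set i | _]; set M' := block_mx _ _ _ _; move=> [u1 u2].
apply/ler_addgt0Pr => e e0.
(* The infimum in Robinson's constant is used only up to an error, scaled so that its product with
   [res] stays below [e]; the 1 covers [res = 0]. *)
have e'0 : 0 < e / (res + 1) by rewrite divr_gt0// ltr_wpDl.
pose t := (l2norm (z - zs))^-1.
have [||v [v1 v2] vlt] :=
  @robinson_mu_solution _ _ _ M' (col_mx N1 N2)^T 0 (t *: (z - zs)) _ e'0.
- exists (t *: u); split; last by rewrite -scalemxAr u2.
  move=> i; rewrite -scalemxAr mxE [leRHS]mxE pmulr_rle0 ?invr_gt0//.
  by apply: le_trans (u1 i) _; rewrite mxE.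
- by rewrite l2norm_col0 l2normZ ger0_norm ?invr_ge0 ?l2norm_ge0// mulVf.
have vle : linfnorm v <= sigma N1 N2 + e / (res + 1).
  apply: le_trans (ltW vlt) _; rewrite lerD2r.
  by rewrite /robinson_sigma; apply: (le_bigmax _ (fun S : {set 'I_m1} => _) S).
have -> : l2norm (z - zs) = dot v (col_mx N1 N2 *m (z - zs)).
  rewrite dot_mulmxr v2 dotZl -l2norm_sqr expr2 mulrA mulVf// mul1r.
  by [].
apply: (@le_trans _ _ (linfnorm v * res)); last first.
  apply: (@le_trans _ _ ((sigma N1 N2 + e / (res + 1)) * res)).
    by rewrite ler_wpM2r.
  rewrite mulrDl lerD2l -mulrA ger_pMr// mulrC ler_pdivrMr ?ltr_wpDl//.
  by rewrite mul1r lerDl.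
rewrite -{1}[v]vsubmxK mul_col_mx dot_col.
have vB i : `|v i 0| <= linfnorm v by exact: le_linfnorm.
rewrite mulrDr; apply: lerD; rewrite mulr_sumr; apply: ler_sum => i _; last first.
  rewrite mulmxBr zsP.2; apply: le_trans (ler_norm _) _.
  by rewrite normrM ler_wpM2r// mxE.
rewrite mulmxBr !mxE.
have viE : usubmx v i 0 = v (lshift m2 i) 0 by rewrite mxE.
rewrite -viE.
have v_ge0 : 0 <= usubmx v i 0.
  have := v1 (rshift _ i); rewrite -[v in _ *m v]vsubmxK mul_block_col.
  by rewrite !mul0mx !addr0 col_mxEd mulNmx mul1mx !mxE oppr_le0.
(* An inactive constraint has multiplier zero; at an active one [N1 zs] equals [b1]. *)
have [iS|iS] := boolP (i \in S).
  have -> : usubmx v i 0 = 0.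
    apply/eqP; rewrite eq_le v_ge0 andbT.
    have := v1 (lshift _ (enum_rank_in iS i)).
    rewrite -[v in _ *m v]vsubmxK mul_block_col.
    by rewrite !mul0mx !addr0 col_mxEu rowsub1E enum_rankK_in// [leRHS]mxE.
  by rewrite mul0r mulr_ge0 ?linfnorm_ge0// le_max lexx orbT.
have -> : \sum_j N1 i j * zs j 0 = b1 i 0.
  have := zsP.1 i; have : i \notin S := iS; rewrite inE -leNgt => h1 h2.
  by apply/eqP; move: h1 h2; rewrite mxE eq_le => -> ->.
apply: (@le_trans _ _ (usubmx v i 0 * Num.max (\sum_j N1 i j * z j 0 - b1 i 0) 0)).
  by rewrite ler_wpM2l// le_max lexx.
rewrite ler_wpM2r ?le_max ?lexx ?orbT// viE.
by apply: le_trans (ler_norm _) (vB _).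
Qed.

End Robinson.

(** * Null space and range space properties *)

Section TopSet.
Variables (R : realFieldType) (I : finType) (w : I -> R) (D : {set I}).
Hypothesis w0 : forall i, 0 <= w i.

(** Greedy choice of a largest remaining element. Either [K] has exactly [k] elements, or [K = D] is
    exhausted and the threshold can be taken to be 0; both cases give the last equation. *)
Lemma top_set_exists (k : nat) : exists (K : {set I}) (theta : R),
  [/\ K \subset D, (#|K| <= k)%N, forall i, i \in K -> theta <= w i,
      forall i, i \in D -> i \notin K -> w i <= theta &
      0 <= theta /\ #|K|%:R * theta = k%:R * theta].
Proof.
have [K [th [KD H thK thD thw]]] : exists (K : {set I}) (theta : R),
  [/\ K \subset D, (#|K| == k) || ((K == D) && (#|K| <= k)%N),
      forall i, i \in K -> theta <= w i,
      forall i, i \in D -> i \notin K -> w i <= theta & 0 <= theta].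
  elim: k => [|k [K [th [KD H thK thD th0]]]].
    exists finset.set0, (\sum_i w i); split; rewrite ?finset.sub0set ?cards0 ?sumr_ge0//.
    - by move=> i; rewrite inE.
    - by move=> i _ _; exact: le_sum_term.
  have [KeD|KnD] := eqVneq K D.
    exists D, 0; split=> // [|i -> //].
    rewrite eqxx /= -KeD; move: H => /orP[/eqP ->|/andP[_ /leqW ->]].
      by rewrite leqnSn orbT.
    by rewrite orbT.
  have /fintype.properP[_ [i0 i0D i0K]] : K \proper D by rewrite finset.properEneq KnD.
  have [i /andP[iD iK] imax] :=
    @arg_min_exists _ _ (fun i => (i \in D) && (i \notin K))
    (fun i => - w i) i0 (introT andP (conj i0D i0K)).
  move: H; rewrite (negPf KnD) orbF => /eqP cK.
  exists (i |: K), (w i); split => //.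
  - by rewrite finset.subUset finset.sub1set iD.
  - by rewrite finset.cardsU1 iK cK eqxx.
  - by move=> j /finset.setU1P[->//|/thK]; apply: le_trans; exact: thD.
  - move=> j jD; rewrite !inE negb_or => /andP[_ jK].
    by have := imax j; rewrite jD jK lerN2; apply.
move: H => /orP[/eqP cK|/andP[/eqP KeD cK]].
  by exists K, th; rewrite cK.
exists D, 0; rewrite -KeD; split => //; rewrite ?mulr0//.
by move=> i ->.
Qed.

(** The last clause is the linear programming form of the sum of the [k] largest weights, and the
    clause on subsets is its case of indicator functions. It holds termwise: [w * v] is at most
    [theta * v], plus [w - theta] on [K], and the thresholds on [K] add up to [k * theta]. *)
Lemma top_set (k : nat) : exists K : {set I},
  [/\ K \subset D, (#|K| <= k)%N,
      forall i, i \in D -> i \notin K -> k%:R * w i <= \sum_(j in K) w j,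
      forall S : {set I}, S \subset D -> (#|S| <= k)%N ->
        \sum_(i in S) w i <= \sum_(i in K) w i &
      forall v : I -> R, (forall i, 0 <= v i <= 1) ->
        \sum_(i in D) v i <= k%:R ->
        \sum_(i in D) w i * v i <= \sum_(i in K) w i].
Proof.
have [K [th [KD Kk thK thD [th0 thk]]]] := top_set_exists k.
have sumth : \sum_(j in K) th = k%:R * th by rewrite sumr_const -thk mulr_natl.
have frac v : (forall i, 0 <= v i <= 1) -> \sum_(i in D) v i <= k%:R ->
    \sum_(i in D) w i * v i <= \sum_(i in K) w i.
  move=> v01 vk.
  apply: (@le_trans _ _ (\sum_(i in D) ((if i \in K then w i - th else 0) + th * v i))).
    apply: ler_sum => i iD; have /andP[v0 v1] := v01 i.
    case: ifP => [/thK|/negbT /(thD i iD)]; nra.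
  rewrite big_split /= -big_mkcondr /=.
  rewrite (eq_bigl [in K]) => [|i]; last first.
    by rewrite andbC; case: (boolP (i \in K)) => //= /(fintype.subsetP KD) ->.
  rewrite sumrB sumth -mulr_sumr -addrA gerDl addrC subr_le0 mulrC ler_wpM2r//.
exists K; split => // [i iD iK|S SD Sk].
  apply: le_trans (_ : k%:R * th <= _); first by rewrite ler_wpM2l ?thD.
  by rewrite -sumth; apply: ler_sum => j /thK.
have S01 i : 0 <= ((i \in S)%:R : R) <= 1 by case: (i \in S); rewrite ?lexx ?ler01.
have mask (f : I -> R) : \sum_(i in D) f i * (i \in S)%:R = \sum_(i in S) f i.
  rewrite big_mkcond [RHS]big_mkcond /=; apply: eq_bigr => i _.
  have [/(fintype.subsetP SD) ->|_] := boolP (i \in S); first by rewrite mulr1.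
  by rewrite mulr0; case: ifP.
rewrite -mask; apply: frac => //.
under eq_bigr do rewrite -[_%:R]mul1r.
by rewrite (mask (fun=> 1)) sumr_const ler_nat.
Qed.

End TopSet.

Section RangeSpace.
Variables (R : realType) (m n : nat) (A : 'M[R]_(m, n)).

Definition weak_NSP k := forall zeta : 'cV[R]_n, A *m zeta = 0 ->
  forall S : {set 'I_n}, (#|S| <= k)%N ->
  \sum_(i in S) `|zeta i 0| <= \sum_(i in ~: S) `|zeta i 0|.

Definition weak_RSP k := forall S1 S2 : {set 'I_n}, [disjoint S1 & S2] ->
  (#|S1| + #|S2| <= k)%N ->
  exists v : 'cV[R]_m, [/\ forall i, i \in S1 -> (A^T *m v) i 0 = 1,
    forall i, i \in S2 -> (A^T *m v) i 0 = -1 &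
    forall i, `|(A^T *m v) i 0| <= 1].

Lemma RSP_weak k : RSP_tr A k -> weak_RSP k.
Proof.
move=> H S1 S2 dS cS; have [z [v zE] [z1 z2 z3]] := H S1 S2 dS cS.
exists v; rewrite -zE; split => // i.
have [i1|i1] := boolP (i \in S1); first by rewrite z1 ?normr1.
have [i2|i2] := boolP (i \in S2); first by rewrite z2// normrN1.
by rewrite ltW// z3// inE negb_or i1.
Qed.

(* By Farkas' lemma, infeasibility of the system for [v] produces a kernel
   vector of [A] whose [l1]-mass sits on [S1 :|: S2]. *)
Lemma weak_NSP_RSP k : weak_NSP k -> weak_RSP k.
Proof.
move=> H S1 S2 dS cS.
(* The first block bounds [A^T v] from above, the second bounds [- A^T v]. The entry -1 on [S2],
   respectively [S1], meets the bound 1 of the other block and turns it into an equality. *)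
pose d : 'cV[R]_(n + n) := col_mx (\col_i (if i \in S2 then -1 else 1))
                               (\col_i (if i \in S1 then -1 else 1)).
have [[v [vd _]]|[p [s [p0]]]] := farkas (col_mx A^T (- A^T)) (0 : 'M_(0, m)) d 0.
  have v1 i : (A^T *m v) i 0 <= if i \in S2 then -1 else 1.
    by have := vd (lshift n i); rewrite mul_col_mx !col_mxEu mxE [leRHS]mxE.
  have v2 i : - (if i \in S1 then -1 else 1) <= (A^T *m v) i 0.
    have := vd (rshift n i); rewrite mul_col_mx !col_mxEd mulNmx mxE [leRHS]mxE.
    by rewrite lerNl.
  have disj i : i \in S1 -> i \in S2 -> False.
    by move=> i1 i2; have := disjointFr dS i1; rewrite i2.
  exists v; split => i.
  - move=> i1; apply/eqP; rewrite eq_le; have := v1 i; have := v2 i; rewrite i1 opprK => ->.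
    by case: ifP => [/(disj _ i1)//|_ ->].
  - move=> i2; apply/eqP; rewrite eq_le; have := v1 i; have := v2 i; rewrite i2 => + ->.
    by case: ifP => [/disj/(_ i2)//|_ ->].
  - have := v1 i; have := v2 i; rewrite ler_norml.
    case: ifP => [i1|_]; case: ifP => [i2|_] => ? ?; apply/andP; split; try lra.
rewrite trmx0 mul0mx addr0 dot0r addr0 -[p]vsubmxK.
set p1 := usubmx p; set p2 := dsubmx p.
rewrite tr_col_mx mul_row_col linearN /= trmxK mulNmx -mulmxBr => kerA.
rewrite ltNge => /negP[]; rewrite dot_col.
have p10 i : 0 <= p1 i 0 by rewrite mxE.
have p20 i : 0 <= p2 i 0 by rewrite mxE.
have cU : (#|S1 :|: S2| <= k)%N by rewrite (leq_trans (leq_card_setU _ _)).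
(* Termwise, with [a], [b] the entries of [p1], [p2]: on [S1] and [S2] the contribution is [a - b]
   or [b - a], at least [-|a - b|]; elsewhere it is [a + b], at least [|a - b|]. *)
have := H _ kerA _ cU; rewrite -subr_ge0 => /le_trans; apply.
rewrite big_mkcond [X in _ - X]big_mkcond -sumrB -big_split /=.
apply: ler_sum => i _; rewrite ![(\col__ _) _ _]mxE.
have -> : (p1 - p2) i 0 = p1 i 0 - p2 i 0 by rewrite [LHS]mxE [(- p2) i 0]mxE.
move: (p10 i) (p20 i); move: (p1 i 0) (p2 i 0) => a b a0 b0.
have := ler_norm (a - b); have := ler_norm (b - a); rewrite distrC.
have : `|a - b| <= a + b by rewrite ler_norml; lra.
rewrite inE finset.in_setU; have [i1|i1] := boolP (i \in S1).
  by rewrite (disjointFr dS i1) /=; lra.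
by case: (boolP (i \in S2)) => i2 /=; lra.
Qed.

Lemma l1norm_subvec (S : {set 'I_n}) (z : 'cV[R]_n) :
  l1norm (subvec S z) = \sum_(i in S) `|z i 0|.
Proof. by rewrite big_enum_val; apply: eq_bigr => i _; rewrite mxE. Qed.

Lemma NSP_weak k : NSP A k -> weak_NSP k.
Proof.
move=> H z Az S Sk; have [->|z0] := eqVneq z 0.
  by rewrite !big1// => i _; rewrite mxE normr0.
by rewrite -!l1norm_subvec ltW// H.
Qed.

Lemma stable_NSP_weak k rho : rho < 1 -> stable_NSP A k rho -> weak_NSP k.
Proof.
move=> rho1 H z Az S Sk; have [->|z0] := eqVneq z 0.
  by rewrite !big1// => i _; rewrite mxE normr0.
rewrite -!l1norm_subvec; apply: le_trans (H z z0 Az S Sk) _.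
by rewrite ler_piMl ?l1norm_ge0 ?ltW.
Qed.

Lemma robust_NSP_weak k N rho1 rho2 : is_norm N -> rho1 < 1 ->
  robust_NSP A N k rho1 rho2 -> weak_NSP k.
Proof.
move=> [_ NZ _] rho1_lt H z Az S Sk; rewrite -!l1norm_subvec.
have := H z S Sk; rewrite Az -(scale0r 0) NZ normr0 mul0r mulr0 addr0 => /le_trans; apply.
by rewrite ler_piMl ?l1norm_ge0 ?ltW.
Qed.

(** Enlarging [S] increases the left side and decreases the right one. The reduction is made because
    coherence is defined through sets of exact cardinality. *)
Lemma weak_NSP_card k : (k <= n)%N ->
  (forall zeta : 'cV[R]_n, A *m zeta = 0 -> forall S : {set 'I_n}, #|S| = k ->
     \sum_(i in S) `|zeta i 0| <= \sum_(i in ~: S) `|zeta i 0|) -> weak_NSP k.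
Proof.
move=> kn H z Az S Sk.
have [T ST cT] : exists2 T : {set 'I_n}, S \subset T & #|T| = k.
  have cS : (k - #|S| <= #|~: S|)%N.
    rewrite [X in (_ <= X)%N]finset.cardsCs finset.setCK card_ord.
    exact: leq_sub2r.
  have [U UP] : exists U : {set 'I_n},
      U \in [set U : {set 'I_n} | U \subset ~: S & #|U| == (k - #|S|)%N].
    by apply/card_gt0P; rewrite cards_draws bin_gt0.
  move: UP; rewrite inE => /andP[US /eqP cU].
  exists (S :|: U); first exact: finset.subsetUl.
  rewrite finset.cardsU (_ : S :&: U = finset.set0).
    by rewrite finset.cards0 subn0 cU subnKC.
  by apply/eqP; rewrite finset.setI_eq0 disjoint_sym finset.disjoints_subset.
apply: le_trans (le_trans (H z Az T cT) _).
  by rewrite [leRHS](big_setID S) /= (finset.setIidPr ST) lerDl sumr_ge0.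
rewrite [leRHS](big_setID (~: T)) /= (finset.setIidPr _) ?finset.setCS//.
by rewrite lerDl sumr_ge0.
Qed.

(** As the columns are normalized, [A z = 0] bounds [|z i|] by the other entries weighted with the
    Gram matrix. Summed over [S], an entry outside [S] receives weight at most mu_1(k), and an entry
    of [S], whose diagonal term is absent, at most mu_1(k-1). *)
Lemma coherence_weak_NSP k : l2_normalized A -> (1 <= k <= n - 1)%N ->
  mutual_coherence A k + mutual_coherence A (k - 1) < 1 -> weak_NSP k.
Proof.
move=> nrm /andP[k1 kn] mu1; apply: weak_NSP_card => [|z Az S cS].
  by rewrite (leq_trans kn)// leq_subr.
pose g i j := ((col i A)^T *m col j A) 0 0.
have gii i : g i i = 1.
  by rewrite /g -dotE -l2norm_sqr nrm expr1n.
have gsum i : \sum_j g i j * z j 0 = 0.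
  transitivity (((col i A)^T *m (A *m z)) 0 0); last by rewrite Az mulmx0 mxE.
  rewrite mulmxA mxE; apply: eq_bigr => j _; congr (_ * _).
  by rewrite /g !mxE; apply: eq_bigr => l _; rewrite !mxE.
have zi i : `|z i 0| <= \sum_(j | j != i) `|g i j| * `|z j 0|.
  have := gsum i; rewrite (bigD1 i)//= gii mul1r => /eqP.
  rewrite addr_eq0 => /eqP ->; rewrite normrN.
  by apply: le_trans (ler_norm_sum _ _ _) _; apply: ler_sum => j _; rewrite normrM.
have mu_ge (l : nat) (T : {set 'I_n}) j : #|T| = l -> j \notin T ->
    \sum_(i in T) `|g j i| <= mutual_coherence A l.
  move=> cT jT; apply: le_trans (le_bigmax _ _ j).
  have := @le_bigmax_cond _ _ _ (0 : R) T
    (fun S : {set 'I_n} => (#|S| == l) && (j \notin S))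
    (fun S => \sum_(i in S) `|g j i|).
  by apply; rewrite cT eqxx.
have mu0 l : 0 <= mutual_coherence A l by exact: bigmax_ge_id.
have gC i j : g i j = g j i by rewrite /g -!dotE dotC.
have key : \sum_(i in S) `|z i 0|
    <= mutual_coherence A k * \sum_(i in ~: S) `|z i 0|
     + mutual_coherence A (k - 1) * \sum_(i in S) `|z i 0|.
  apply: (@le_trans _ _ (\sum_(i in S) \sum_(j | j != i) `|g i j| * `|z j 0|)).
    exact: ler_sum.
  rewrite (exchange_big_dep predT)//= (bigID [in S])/= addrC.
  rewrite !mulr_sumr; apply: lerD.
    rewrite (eq_bigl [in ~: S]) => [|j]; last by rewrite inE.
    apply: ler_sum => j; rewrite inE => jS; rewrite -mulr_suml ler_wpM2r//.
    rewrite (eq_bigl [in S]) => [|i]; last first.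
      by rewrite andb_idr// => iS; apply: contraNneq jS => ->.
    by under eq_bigr do rewrite gC; exact: mu_ge.
  apply: ler_sum => j jS; rewrite -mulr_suml ler_wpM2r//.
  rewrite (eq_bigl [in S :\ j]) => [|i]; last by rewrite !inE andbC eq_sym.
  under eq_bigr do rewrite gC; apply: mu_ge; last by rewrite !inE eqxx.
  by apply/eqP; rewrite -(eqn_add2l 1) -cS subnKC ?cS// -cS (cardsD1 j S) jS.
have arith (a b x y : R) : 0 <= b -> 0 <= x -> 0 <= y -> x + y < 1 ->
    a <= x * b + y * a -> a <= b.
  by move=> *; rewrite leNgt; apply/negP => ab; nra.
by apply: arith mu1 key; rewrite ?mu0 ?sumr_ge0.
Qed.

End RangeSpace.

(** * Restricted isometry implies the weak null space property *)

Section RestrictedIsometry.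
Variables (R : realType) (m n : nat) (A : 'M[R]_(m, n)).

(** [P], [Q], [W] are the Gram entries of the images of two orthogonal vectors with squared norms
    [X] and [U]. Subtracting four times [up] from [low] eliminates [W] and leaves
    [4 (3 r - 4) (P + Q) <= 0] on the right. With [U <= X] and [6 - 4 r = r (3 r - 4)] the left is
    at least [4 (3 r - 4) (1 - delta r) X > 0]. *)
Lemma cai_zhang_arith (delta P Q W X U r : R) : r ^+ 2 = 2 -> 0 < r ->
  0 < delta -> delta * r < 1 -> 0 < X -> 0 <= U <= X -> P + Q <= 0 ->
  (3 / 2 - r) ^+ 2 * P - (3 / 2 - r) * (r - 1) * Q + ((r - 1) / 2) ^+ 2 * W
    <= (1 + delta) * ((3 / 2 - r) ^+ 2 * X + ((r - 1) / 2) ^+ 2 * U) ->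
  (1 - delta) * (X + (r - 1) ^+ 2 * U) <= P + 2 * (r - 1) * Q + (r - 1) ^+ 2 * W ->
  False.
Proof.
move=> r2 r0 d0 dr X0 /andP[U0 UX] PQ up low.
have rr : r * r = 2 by rewrite -expr2.
have r14 : 4 / 3 < r by rewrite ltNge; apply/negP => ?; nra.
have r15 : r < 3 / 2 by rewrite ltNge; apply/negP => ?; nra.
have h1 : (3 / 2 - r) ^+ 2 = 17 / 4 - 3 * r by rewrite !expr2; lra.
have h2 : (r - 1) ^+ 2 = 3 - 2 * r by rewrite !expr2; lra.
have h3 : (3 / 2 - r) * (r - 1) = 5 / 2 * r - 7 / 2 by lra.
have h4 : ((r - 1) / 2) ^+ 2 = (3 - 2 * r) / 4 by rewrite exprMn h2; lra.
rewrite h1 h3 h4 in up; rewrite h2 in low.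
have PQ' : 0 <= (4 - 3 * r) * (P + Q) by nra.
have dU : delta * ((3 - 2 * r) / 2) * U <= delta * ((3 - 2 * r) / 2) * X.
  by rewrite ler_wpM2l// mulr_ge0 ?ltW//; lra.
have : 0 <= ((4 - 3 * r) + delta * (6 - 4 * r)) * X by lra.
have : delta * (6 - 4 * r) = (delta * r) * (3 * r - 4).
  by rewrite -mulrA; congr (_ * _); lra.
move=> ->.
by nra.
Qed.

Lemma dot_lincomb p (a b : R) (u v : 'cV[R]_p) :
  dot (a *: u + b *: v) (a *: u + b *: v)
  = a ^+ 2 * dot u u + 2 * a * b * dot u v + b ^+ 2 * dot v v.
Proof. by rewrite !(dotDr, dotDl, dotZr, dotZl) (dotC v u); ring. Qed.

(* The sharp bound of Cai and Zhang. Let [hT] be the restriction of a kernel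
   vector [h] to its [k] largest entries. The tested combinations of [hT] and a
   [k]-sparse [u] are chosen so that the quadratic terms in [A u] cancel; the
   remaining functional is linear in [u], so [u] may be taken to be a
   [k]-sparse minimiser of it. *)
Lemma RIP_weak_NSP k delta : 0 < delta -> delta < (Num.sqrt 2)^-1 ->
  RIP A (2 * k) delta -> weak_NSP A k.
Proof.
move=> d0 d2 rip h Ah S Sk; rewrite leNgt; apply/negP => hS.
have [T [_ Tk Tmax Tsum _]] := @top_set _ _ (fun i => `|h i 0|) [set: 'I_n]%SET
  (fun=> normr_ge0 _) k.
set sT := \sum_(j in T) `|h j 0| in Tmax Tsum.
have ST : \sum_(i in S) `|h i 0| <= sT. by apply: Tsum => //; exact: finset.subsetT.
have split_sum (V : {set 'I_n}) :
    \sum_i `|h i 0| = \sum_(i in V) `|h i 0| + \sum_(i in ~: V) `|h i 0|.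
  rewrite (bigID [in V]) /=; congr (_ + _); apply: eq_bigl => i.
  by rewrite inE.
have sTc : \sum_(i in ~: T) `|h i 0| < sT.
  by have := split_sum S; rewrite (split_sum T) -/sT; lra.
have sT0 : 0 < sT by apply: le_lt_trans sTc; exact: sumr_ge0.
have k0 : (0 < k)%N.
  rewrite lt0n; apply: contraTneq sT0 => k0.
  move: Tk; rewrite k0 leqn0 cards_eq0 => /eqP T0.
  by rewrite /sT T0 big_set0 ltxx.
have kR0 : 0 < k%:R :> R by rewrite ltr0n.
(* By the choice of [T] this bounds every entry off [T], so the entries off [T] divided by [al] are
   fractional weights of total at most [k]. *)
pose al := sT / k%:R.
have al0 : 0 < al by rewrite divr_gt0.
have kal : k%:R * al = sT by rewrite mulrC divfK ?gt_eqF.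
pose hT : 'cV[R]_n := \col_i (if i \in T then h i 0 else 0).
pose X := dot hT hT.
have XE : X = \sum_(i in T) `|h i 0| ^+ 2.
  rewrite [RHS]big_mkcond; apply: eq_bigr => i _; rewrite mxE.
  by case: ifP => _; rewrite ?mulr0// real_normK ?num_real// expr2.
have Xge : k%:R * al ^+ 2 <= X.
  have : 0 <= \sum_(i in T) (`|h i 0| - al) ^+ 2.
    by apply: sumr_ge0 => i _; exact: sqr_ge0.
  have -> : \sum_(i in T) (`|h i 0| - al) ^+ 2
      = X - 2 * al * sT + #|T|%:R * al ^+ 2.
    rewrite XE /sT mulr_sumr [#|T|%:R * _]mulr_natl -sumr_const -sumrB.
    rewrite -big_split /=.
    by apply: eq_bigr => i _; ring.
  have : #|T|%:R * al ^+ 2 <= k%:R * al ^+ 2.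
    by rewrite ler_wpM2r ?sqr_ge0// ler_nat.
  by rewrite -kal; lra.
have X0 : 0 < X by apply: lt_le_trans Xge; rewrite mulr_gt0 ?exprn_gt0.
pose c := A^T *m (A *m hT).
have [K [KT Kk _ _ Ksum]] := @top_set _ _ (fun i => `|c i 0|) (~: T)
  (fun=> normr_ge0 _) k.
pose u : 'cV[R]_n := \col_i (if i \in K then - al * Num.sg (c i 0) else 0).
have uE i : u i 0 ^+ 2 <= (if i \in K then al ^+ 2 else 0).
  rewrite mxE; case: ifP => _; last by rewrite expr0n.
  rewrite exprMn sqrrN ler_piMr ?sqr_ge0//.
  by rewrite sqr_sg; case: (c i 0 != 0); rewrite ?ler01.
have U_le : dot u u <= k%:R * al ^+ 2.
  apply: (@le_trans _ _ (\sum_(i in K) al ^+ 2)).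
    by rewrite [leRHS]big_mkcond; apply: ler_sum => i _; rewrite -expr2.
  by rewrite sumr_const -[_ *+ #|_|]mulr_natl ler_wpM2r ?sqr_ge0// ler_nat.
have Xu : dot hT u = 0.
  apply: big1 => i _; rewrite !mxE; case: ifP => [iT|]; last by rewrite mul0r.
  case: ifP => [iK|]; last by rewrite mulr0.
  by have := fintype.subsetP KT i iK; rewrite inE iT.
have sparse a b : (l0norm (a *: hT + b *: u) <= 2 * k)%N.
  apply: leq_trans (_ : #|T :|: K| <= _)%N.
    apply: subset_leq_card; apply/fintype.subsetP => i; rewrite !inE !mxE.
    by case: ifP => //=; case: ifP => //=; rewrite !mulr0 addr0 eqxx.
  by rewrite (leq_trans (leq_card_setU _ _))// mul2n -addnn leq_add.
have ripE a b : (1 - delta) * (a ^+ 2 * X + b ^+ 2 * dot u u)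
   <= a ^+ 2 * dot (A *m hT) (A *m hT) + 2 * a * b * dot (A *m hT) (A *m u)
      + b ^+ 2 * dot (A *m u) (A *m u)
   <= (1 + delta) * (a ^+ 2 * X + b ^+ 2 * dot u u).
  have [] := rip _ (sparse a b); rewrite !l2norm_sqr mulmxDr -!scalemxAr.
  by rewrite !dot_lincomb Xu mulr0 addr0 => -> ->.
(* Since [A h = 0], the functional [c] takes the value [- dot (A hT) (A hT)] at [h - hT]; the
   fractional clause of [top_set] shows that its value at [u] is no larger. *)
have PQ : dot (A *m hT) (A *m hT) + dot (A *m hT) (A *m u) <= 0.
  have -> : dot (A *m hT) (A *m u) = - (al * \sum_(i in K) `|c i 0|).
    rewrite dot_mulmxr -/c mulr_sumr -sumrN [RHS]big_mkcond.
    apply: eq_bigr => i _; rewrite [u i 0]mxE; case: ifP => _; last by rewrite mulr0.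
    by rewrite normrEsg; ring.
  have -> : dot (A *m hT) (A *m hT) = - dot c (h - hT).
    by rewrite -dot_mulmxr mulmxBr Ah sub0r dotNr opprK.
  pose v i := if i \in ~: T then `|h i 0| / al else 0.
  have v01 i : 0 <= v i <= 1.
    rewrite /v; case: ifP => [iT|_]; last by rewrite lexx ler01.
    apply/andP; split; first by rewrite divr_ge0 ?normr_ge0// ltW.
    move: iT; rewrite inE ler_pdivrMr// mul1r -(ler_pM2l kR0) kal.
    by apply: Tmax; rewrite finset.in_setT.
  have vk : \sum_(i in ~: T) v i <= k%:R.
    rewrite (eq_bigr (fun i => `|h i 0| / al)) => [|i iT]; last by rewrite /v iT.
    by rewrite /= -mulr_suml ler_pdivrMr// kal ltW.
  have := Ksum v v01 vk; rewrite -(ler_pM2l al0) => vK.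
  rewrite -opprD oppr_le0 -[leLHS]addr0.
  suff : - (al * \sum_(i in ~: T) `|c i 0| * v i) <= dot c (h - hT) by lra.
  rewrite mulr_sumr -sumrN big_mkcond; apply: ler_sum => i _.
  have -> : (h - hT) i 0 = if i \in T then 0 else h i 0.
    by rewrite !mxE; case: ifP; rewrite ?subrr ?subr0.
  rewrite /v inE; case: (i \in T) => /=; first by rewrite mulr0.
  by rewrite mulrCA [al * _]mulrC divfK ?gt_eqF// lerNl -normrM -normrN ler_norm.
have r2 : Num.sqrt 2 ^+ 2 = 2 :> R by rewrite sqr_sqrtr.
have r0 : 0 < Num.sqrt 2 :> R by rewrite sqrtr_gt0.
set r := Num.sqrt 2 in d2 r2 r0.
have dr : delta * r < 1 by rewrite -ltr_pdivlMr// div1r.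
apply: (@cai_zhang_arith delta (dot (A *m hT) (A *m hT)) (dot (A *m hT) (A *m u))
  (dot (A *m u) (A *m u)) X (dot u u) r) => //.
- by rewrite dot_ge0 (le_trans U_le).
- have /andP[_] := ripE (3 / 2 - r) (- ((r - 1) / 2)).
  by rewrite sqrrN; congr (_ <= _); congr (_ + _ + _); lra.
- have /andP[+ _] := ripE 1 (r - 1).
  by rewrite expr1n !mul1r mulr1.
Qed.

End RestrictedIsometry.

(** * Dual certificates and the constant c *)

Section Certificate.
Variables (R : realType) (m n q : nat).

Lemma gram_unitmx (A : 'M[R]_(m, n)) : \rank A = m -> A *m A^T \in unitmx.
Proof.
move=> rA; rewrite -row_free_unit -kermx_eq0; apply/rowV0P => v /sub_kermxP vAA.
have vA : (A^T *m v^T) = 0.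
  have AAv : (A *m A^T *m v^T) = (v *m (A *m A^T))^T by rewrite !trmx_mul trmxK.
  by apply: dot_eq0; rewrite dot_mulmxl trmxK mulmxA AAv vAA trmx0 dot0r.
have rf : row_free A by rewrite /row_free rA.
by apply: (row_free_inj rf); rewrite mul0mx -[LHS]trmxK trmx_mul vA trmx0.
Qed.

Lemma l1norm_colsub1 p (f : 'I_p -> 'I_q) (g : 'cV[R]_p) :
  l1norm (colsub f 1%:M *m g) <= l1norm g.
Proof.
apply: (@le_trans _ _ (\sum_i \sum_j (i == f j)%:R * `|g j 0|)).
  apply: ler_sum => i _; rewrite mxE; apply: le_trans (ler_norm_sum _ _ _) _.
  by apply: ler_sum => j _; rewrite !mxE normrM normr_nat.
rewrite exchange_big /=; apply: ler_sum => j _; rewrite (bigD1 (f j))//= eqxx mul1r.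
by rewrite big1 ?addr0// => i /negPf ->; rewrite mul0r.
Qed.

Lemma norm_infty_to_1_ub p r (Q : 'M[R]_(p, r)) (x : 'cV[R]_r) :
  linfnorm x <= 1 -> l1norm (Q *m x) <= norm_infty_to_1 Q.
Proof.
move=> x1; apply: ub_le_sup; last by exists x.
exists (\sum_i \sum_j `|Q i j|) => _ [z /= z1 <-].
apply: ler_sum => i _; rewrite mxE; apply: le_trans (ler_norm_sum _ _ _) _.
apply: ler_sum => j _; rewrite normrM ler_piMr//.
by apply: le_trans z1; exact: le_linfnorm.
Qed.

(** Stated for a variable [p], so that the equation [p = m] can be substituted away; with [#|G|] in
    place of [p] this is impossible. *)
Lemma conform_mx_square p (B : 'M[R]_(m, p)) : p = m ->
  row_full B^T -> (conform_mx (0 : 'M_m) B \in unitmx) /\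
  forall w : 'cV_m, exists2 g : 'cV_p, B *m g = conform_mx (0 : 'M_m) B *m w &
    l1norm g = l1norm w.
Proof.
move=> pm; subst p; rewrite conform_mx_id row_full_unit unitmx_tr => BU.
by split => // w; exists w.
Qed.

(** The formula for c comes from the identity [v = (A A^T)^-1 A (A^T v)], whose last factor has
    maximum norm at most 1. A full-rank selection of rows of [M^T] supplies [G], and [h] is
    [M_G^-1 v] padded with zeros. *)
Lemma const_c_certificate (A : 'M[R]_(m, n)) (M : 'M[R]_(m, q)) (v : 'cV[R]_m) :
  \rank A = m -> \rank M = m -> (forall i, `|(A^T *m v) i 0| <= 1) ->
  exists2 h : 'cV[R]_q, M *m h = v & l1norm h <= const_c A M.
Proof.
move=> rA rM v1.
have MTfull : row_full M^T by rewrite /row_full mxrank_tr rM.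
pose f := fullrankfun MTfull.
pose G : {set 'I_q} := [set f i | i : 'I_m]%SET.
have cG : #|G| = m by rewrite card_imset ?card_ord//; exact: fullrankfun_inj.
pose B := colsub (@enum_val _ (mem G)) M.
have Bfull : row_full B^T.
  rewrite -sub1mx; have := fullrowsub_full MTfull; rewrite -sub1mx => /submx_trans; apply.
  apply/row_subP => i; rewrite row_rowsub.
  have fG : f i \in G by apply/imsetP; exists i.
  have -> : row (f i) M^T = row (enum_rank_in fG (f i)) B^T.
    by apply/rowP => j; rewrite !mxE enum_rankK_in.
  exact: row_sub.
have [BU Bsol] := conform_mx_square cG Bfull.
have [g Bg gE] := Bsol (invmx (msub M G) *m v).
exists (colsub (@enum_val _ (mem G)) 1%:M *m g).
  by rewrite mulmxA mulmx_colsub mulmx1 -/B Bg mulmxA mulmxV ?mul1mx.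
apply: le_trans (l1norm_colsub1 _ _) _; rewrite gE.
have -> : invmx (msub M G) *m v
    = invmx (msub M G) *m invmx (A *m A^T) *m A *m (A^T *m v).
  by rewrite !mulmxA -[_ *m A *m A^T]mulmxA mulmxKV ?gram_unitmx.
apply: le_trans (norm_infty_to_1_ub _ _) _; first by apply: linfnorm_le.
apply: (@le_bigmax_cond _ _ _ (0 : R) G
  (fun G : {set 'I_q} => (#|G| == m) && (msub M G \in unitmx))
  (fun G => norm_infty_to_1 (invmx (msub M G) *m invmx (A *m A^T) *m A))).
by rewrite cG eqxx.
Qed.

Lemma l0norm0 : l0norm (0 : 'cV[R]_n) = 0%N.
Proof. by apply: eq_card0 => i; rewrite !inE mxE eqxx. Qed.

(** With [T] carrying the [k] largest entries, the terms on [T] cancel and each term off [T] costs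
    at most twice its modulus, whence the factor 2. No [k]-sparse vector approximates [x] better
    than its restriction to [T]. *)
Lemma weak_RSP_certificate (A : 'M[R]_(m, n)) k (x : 'cV[R]_n) : weak_RSP A k ->
  exists2 v : 'cV[R]_m, forall i, `|(A^T *m v) i 0| <= 1 &
    l1norm x - dot x (A^T *m v) <= 2 * best_approx1 k x.
Proof.
move=> rsp.
have [T [_ Tk _ Tsum _]] := @top_set _ _ (fun i => `|x i 0|) [set: 'I_n]%SET
  (fun=> normr_ge0 _) k.
pose S1 := [set i in T | 0 < x i 0]%SET; pose S2 := [set i in T | x i 0 < 0]%SET.
have dS : [disjoint S1 & S2].
  rewrite -finset.setI_eq0; apply/eqP/setP => i; rewrite !inE.
  by case: (i \in T) => //=; case: ltgtP.
have cS : (#|S1| + #|S2| <= k)%N.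
  have [_ ] := leq_card_setU S1 S2; rewrite dS => /eqP <-; apply: leq_trans Tk.
  apply: subset_leq_card; apply/fintype.subsetP => i; rewrite !inE.
  by case/orP => /andP[].
have [v [v1 v2 v3]] := rsp S1 S2 dS cS; exists v => //.
apply: (@le_trans _ _ (2 * \sum_(i in ~: T) `|x i 0|)).
  rewrite -sumrB mulr_sumr [leRHS]big_mkcond; apply: ler_sum => i _; rewrite inE.
  have [iT|iT] /= := boolP (i \in T).
    have [x0|x0|x0] := ltgtP (x i 0) 0.
    - by rewrite v2 ?inE ?iT ?x0// mulrN1 opprK ltr0_norm// addNr.
    - by rewrite v1 ?inE ?iT ?x0// mulr1 gtr0_norm// subrr.
    - by rewrite x0 normr0 mul0r subrr.
  rewrite mulr2n mulrDl mul1r lerD2l; apply: le_trans (ler_norm _) _.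
  by rewrite normrN normrM ler_piMr.
rewrite ler_pM2l//; apply: lb_le_inf.
  by exists (l1norm (x - 0)), 0 => //=; rewrite l0norm0.
move=> _ [u /= u0 <-].
pose S := [set i | u i 0 != 0]%SET.
have splitS (V : {set 'I_n}) :
    \sum_i `|x i 0| = \sum_(i in V) `|x i 0| + \sum_(i in ~: V) `|x i 0|.
  by rewrite (bigID [in V]) /=; congr (_ + _); apply: eq_bigl => i; rewrite inE.
have := Tsum S (finset.subsetT _) u0.
suff : \sum_(i in ~: S) `|x i 0| <= l1norm (x - u).
  by have := splitS S; rewrite (splitS T); lra.
rewrite big_mkcond; apply: ler_sum => i _; rewrite !inE !mxE.
by rewrite negbK; case: eqP => [->|_] /=; rewrite ?subr0 ?normr_ge0 ?lexx.
Qed.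

End Certificate.

(** * Optimality system of the linear program *)

Section Blocks.
Variable R : realType.

Definition vsum n (u : 'cV[R]_n) : R := \sum_i u i 0.

Definition nonpos n (u : 'cV[R]_n) : Prop := forall i, u i 0 <= 0.

Definition posl1 n (u : 'cV[R]_n) : R := \sum_i Num.max (u i 0) 0.

(** Unlike [mxE], these entrywise rules leave matrix products folded, so that entries of products
    remain atoms for [lra]. *)
Lemma cvE_add p (u v : 'cV[R]_p) i : (u + v) i 0 = u i 0 + v i 0.
Proof. exact: mxE. Qed.

Lemma cvE_opp p (u : 'cV[R]_p) i : (- u) i 0 = - u i 0.
Proof. exact: mxE. Qed.

Lemma cvE_const p (a : R) (i : 'I_p) : (const_mx a : 'cV[R]_p) i 0 = a.
Proof. exact: mxE. Qed.

Lemma dot_const n (u : 'cV[R]_n) a : dot u (const_mx a) = a * vsum u.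
Proof. by rewrite mulr_sumr; apply: eq_bigr => i _; rewrite mxE mulrC. Qed.

Lemma dot_scalar a b : dot (a%:M : 'cV[R]_1) b%:M = a * b.
Proof. by rewrite /dot big_ord1 !mxE eqxx !mulr1n. Qed.

Lemma posl1_col p n (u : 'cV[R]_p) (v : 'cV[R]_n) :
  posl1 (col_mx u v) = posl1 u + posl1 v.
Proof.
rewrite /posl1 big_split_ord /=.
by congr (_ + _); apply: eq_bigr => i _; rewrite ?col_mxEu ?col_mxEd.
Qed.

Lemma posl1_nonpos n (u : 'cV[R]_n) : nonpos u -> posl1 u = 0.
Proof. by move=> u0; apply: big1 => i _; apply/max_idPr. Qed.

Lemma posl1_scalar a : posl1 (a%:M : 'cV[R]_1) = Num.max a 0.
Proof. by rewrite /posl1 big_ord1 !mxE eqxx. Qed.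

Lemma l1norm_col p n (u : 'cV[R]_p) (v : 'cV[R]_n) :
  l1norm (col_mx u v) = l1norm u + l1norm v.
Proof.
rewrite /l1norm big_split_ord /=.
by congr (_ + _); apply: eq_bigr => i _; rewrite ?col_mxEu ?col_mxEd.
Qed.

Lemma l2norm_col_le p n (u : 'cV[R]_p) (v : 'cV[R]_n) :
  l2norm u <= l2norm (col_mx u v).
Proof.
rewrite -(ler_pXn2r (n := 2)) ?nnegrE ?l2norm_ge0// !l2norm_sqr dot_col.
by rewrite lerDl dot_ge0.
Qed.

Lemma col_mx_ex p n (u : 'cV[R]_(p + n)) : exists a b, u = col_mx a b.
Proof. by exists (usubmx u), (dsubmx u); rewrite vsubmxK. Qed.

Lemma scalar_ex (u : 'cV[R]_1) : exists a, u = a%:M.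
Proof. by exists (u 0 0); exact: mx11_scalar. Qed.

Lemma nonneg_col_ex p n (u : 'cV[R]_(p + n)) : (forall i, 0 <= u i 0) ->
  exists a b, [/\ u = col_mx a b, forall i, 0 <= a i 0 & forall i, 0 <= b i 0].
Proof.
move=> u0; exists (usubmx u), (dsubmx u).
by split=> [|i|i]; rewrite ?vsubmxK// mxE.
Qed.

Lemma nonneg_scalar_ex (u : 'cV[R]_1) : (forall i, 0 <= u i 0) ->
  exists2 a, u = a%:M & 0 <= a.
Proof. by move=> u0; exists (u 0 0) => //; exact: mx11_scalar. Qed.

Lemma dot_nonneg n (u v : 'cV[R]_n) :
  (forall i, 0 <= u i 0) -> (forall i, 0 <= v i 0) -> 0 <= dot u v.
Proof. by move=> u0 v0; apply: sumr_ge0 => i _; rewrite mulr_ge0. Qed.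

End Blocks.

Section OptimalitySystem.
Variables (R : realType) (m n q : nat).
Variables (A : 'M[R]_(m, n)) (M : 'M[R]_(m, q)).
Variables (y : 'cV[R]_m) (tau alpha : R).

Notation M1 := (matM1 A M alpha).
Notation M2 := (matM2 A M y tau).

(** In the polyhedron, [t], [r], [s] majorise [|x|], the maximum norm and the moduli of [theta x].
    The multipliers of the first seven block rows of [matM1] are, in order, [w1], [w2], [w3], [w5],
    [w4], [w6], [w7], with [w4] and [w5] exchanged. *)
Definition kktvec (x t : 'cV[R]_n) (r : R) (s : 'cV[R]_q) (w1 w2 : 'cV[R]_n)
    (w3 : R) (w4 w5 w6 w7 : 'cV[R]_q) :=
  col_mx x (col_mx t (col_mx (r%:M : 'cV_1) (col_mx s (col_mx w1 (col_mx w2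
    (col_mx (w3%:M : 'cV_1) (col_mx w4 (col_mx w5 (col_mx w6 w7))))))))).

Definition kktrhs :=
  col_mx (0 : 'cV[R]_n) (col_mx (0 : 'cV[R]_n) (col_mx (tau%:M : 'cV_1)
    (col_mx (M^T *m y) (col_mx (- (M^T *m y)) (col_mx (M^T *m y)
    (col_mx (- (M^T *m y)) (col_mx (const_mx 1 : 'cV[R]_n)
    (col_mx (0%:M : 'cV[R]_1) (col_mx (0 : 'cV[R]_q) (col_mx (0 : 'cV[R]_n)
    (col_mx (0 : 'cV[R]_n) (col_mx (0%:M : 'cV[R]_1) (col_mx (0 : 'cV[R]_q)
    (col_mx (0 : 'cV[R]_q) (col_mx (0 : 'cV[R]_q) (0 : 'cV[R]_q)))))))))))))))).

Lemma kktvec_ex z : exists x t r s w1 w2 w3 w4 w5 w6 w7,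
  z = kktvec x t r s w1 w2 w3 w4 w5 w6 w7.
Proof.
have [x [z1 ->]] := col_mx_ex z; have [t [z2 ->]] := col_mx_ex z1.
have [r' [z3 ->]] := col_mx_ex z2; have [r ->] := scalar_ex r'.
have [s [z4 ->]] := col_mx_ex z3.
have [w1 [z5 ->]] := col_mx_ex z4; have [w2 [z6 ->]] := col_mx_ex z5.
have [w3' [z7 ->]] := col_mx_ex z6; have [w3 ->] := scalar_ex w3'.
have [w4 [z8 ->]] := col_mx_ex z7; have [w5 [z9 ->]] := col_mx_ex z8.
have [w6 [w7 ->]] := col_mx_ex z9.
by exists x, t, r, s, w1, w2, w3, w4, w5, w6; exists w7.
Qed.

Section Products.
Variables (x t : 'cV[R]_n) (r : R) (s : 'cV[R]_q) (w1 w2 : 'cV[R]_n) (w3 : R).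
Variables (w4 w5 w6 w7 : 'cV[R]_q).
Notation z := (kktvec x t r s w1 w2 w3 w4 w5 w6 w7).
Notation h := (w4 - w5 - w6 + w7).

Lemma blockrow_kktvec p (B1 B2 : 'M[R]_(p, n)) (B3 : 'M[R]_(p, 1))
    (B4 : 'M[R]_(p, q)) (B5 B6 : 'M[R]_(p, n)) (B7 : 'M[R]_(p, 1))
    (B8 B9 B10 B11 : 'M[R]_(p, q)) :
  blockrow B1 B2 B3 B4 B5 B6 B7 B8 B9 B10 B11 *m z =
  B1 *m x + (B2 *m t + (r *: B3 + (B4 *m s + (B5 *m w1 + (B6 *m w2 +
    (w3 *: B7 + (B8 *m w4 + (B9 *m w5 + (B10 *m w6 + B11 *m w7))))))))).
Proof. by rewrite /blockrow /kktvec !mul_row_col !mul_mx_scalar. Qed.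

Lemma mul_ones p (u : 'cV[R]_p) : (const_mx 1 : 'cV[R]_p)^T *m u = (vsum u)%:M.
Proof.
apply/matrixP => i j; rewrite !ord1 !mxE eqxx mulr1n.
by apply: eq_bigr => k _; rewrite !mxE mul1r.
Qed.

Definition kktlhs :=
  col_mx (x - t) (col_mx (- x - t)
    (col_mx ((alpha * r + (1 - alpha) * vsum s)%:M : 'cV[R]_1)
    (col_mx (M^T *m (A *m x) - const_mx r) (col_mx (- (M^T *m (A *m x)) - const_mx r)
    (col_mx (M^T *m (A *m x) - s) (col_mx (- (M^T *m (A *m x)) - s)
    (col_mx (w1 + w2)
    (col_mx ((- alpha * w3 + vsum w4 + vsum w5)%:M : 'cV[R]_1)
    (col_mx (w6 + w7 - const_mx ((1 - alpha) * w3))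
    (col_mx (- w1) (col_mx (- w2) (col_mx ((- w3)%:M : 'cV[R]_1)
    (col_mx (- w4) (col_mx (- w5) (col_mx (- w6) (- w7)))))))))))))))).

Lemma mul_col_mx_eq p1 p2 l (B : 'M[R]_(p1, l)) (C : 'M[R]_(p2, l))
    (v : 'cV[R]_l) b c :
  B *m v = b -> C *m v = c -> col_mx B C *m v = col_mx b c.
Proof. by move=> <- <-; rewrite mul_col_mx. Qed.

Lemma matM1_kktvec : M1 *m z = kktlhs.
Proof.
have cE p (a : R) : a *: (const_mx 1 : 'cV[R]_p) = const_mx a.
  by apply/colP => i; rewrite !mxE mulr1.
pose simp := (mul0mx, @scaler0, addr0, add0r, @mulNmx, mul1mx, @scalerN).
rewrite /matM1 /kktlhs.
apply: mul_col_mx_eq; first by rewrite blockrow_kktvec !simp.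
apply: mul_col_mx_eq; first by rewrite blockrow_kktvec !simp.
apply: mul_col_mx_eq.
  rewrite blockrow_kktvec !simp.
  by rewrite -scalemxAl mul_ones !scale_scalar_mx -raddfD mulrC.
apply: mul_col_mx_eq.
  rewrite blockrow_kktvec !simp.
  by rewrite -mulmxA ?cE.
apply: mul_col_mx_eq.
  rewrite blockrow_kktvec !simp.
  by rewrite -mulmxA ?cE.
apply: mul_col_mx_eq.
  rewrite blockrow_kktvec !simp.
  by rewrite -mulmxA ?cE.
apply: mul_col_mx_eq.
  rewrite blockrow_kktvec !simp.
  by rewrite -mulmxA ?cE.
apply: mul_col_mx_eq; first by rewrite blockrow_kktvec !simp.
apply: mul_col_mx_eq.
  rewrite blockrow_kktvec !simp.
  rewrite !mul_ones !scale_scalar_mx -raddfN -!raddfD; congr (_%:M) => /=.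
  by ring.
apply: mul_col_mx_eq.
  rewrite blockrow_kktvec !simp.
  by apply/colP => i; rewrite !mxE; ring.
apply: mul_col_mx_eq; first by rewrite blockrow_kktvec !simp.
apply: mul_col_mx_eq; first by rewrite blockrow_kktvec !simp.
apply: mul_col_mx_eq.
  rewrite blockrow_kktvec !simp.
  by rewrite scale_scalar_mx mulr1 raddfN.
apply: mul_col_mx_eq; first by rewrite blockrow_kktvec !simp.
apply: mul_col_mx_eq; first by rewrite blockrow_kktvec !simp.
apply: mul_col_mx_eq; first by rewrite blockrow_kktvec !simp.
by rewrite blockrow_kktvec !simp.
Qed.

Lemma matM2_kktvec : M2 *m z =
  col_mx (w2 - w1 + A^T *m (M *m h))
    ((vsum t + tau * w3 - dot y (M *m h))%:M : 'cV[R]_1).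
Proof.
have yME u : y^T *m M *m u = (dot y (M *m u))%:M.
  by rewrite -mulmxA dotE; apply: mx11_scalar.
apply: mul_col_mx_eq; rewrite blockrow_kktvec;
  rewrite !(mul0mx, scaler0, addr0, add0r, mulNmx, mul1mx).
  by rewrite !mulmxDr !mulmxN !mulmxA -!addrA addrCA.
rewrite mul_ones scale_scalar_mx !yME -!raddfN -!raddfD; congr (_%:M) => /=.
by rewrite !mulmxDr !mulmxN !(dotDr, dotNr); ring.
Qed.

End Products.
End OptimalitySystem.

(** * Points of the polyhedron give optimal solutions *)

Section Optimality.
Variables (R : realType) (m n q : nat).
Variables (A : 'M[R]_(m, n)) (M : 'M[R]_(m, q)).
Variables (y : 'cV[R]_m) (tau alpha : R).
Hypothesis tau0 : 0 <= tau.
Hypothesis alpha01 : 0 <= alpha <= 1.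

Notation M1 := (matM1 A M alpha).
Notation M2 := (matM2 A M y tau).
Notation th := (theta A M y).
Notation rhs := (kktrhs n M y tau).

Lemma lev_col p1 p2 (a c : 'cV[R]_p1) (b d : 'cV[R]_p2) :
  (forall i, col_mx a b i 0 <= col_mx c d i 0) ->
  (forall i, a i 0 <= c i 0) /\ (forall i, b i 0 <= d i 0).
Proof.
move=> h; split=> i; first by have := h (lshift p2 i); rewrite !col_mxEu.
by have := h (rshift p1 i); rewrite !col_mxEd.
Qed.

Lemma dot_le_l1norm p (u v : 'cV[R]_p) :
  (forall i, `|v i 0| <= 1) -> dot u v <= l1norm u.
Proof.
move=> v1; apply: ler_sum => i _; apply: le_trans (ler_norm _) _.
by rewrite normrM ler_piMr.
Qed.

Lemma thetaE x : th x = M^T *m (A *m x) - M^T *m y.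
Proof. by rewrite /theta mulmxBr. Qed.

Lemma dot_yM x h : dot y (M *m h) = dot x (A^T *m (M *m h)) - dot (th x) h.
Proof. by rewrite thetaE dotBl !dot_mulmxl !trmxK; ring. Qed.

(* The constraint norm of [(P)] is dual to the one cut out by the multipliers. *)
Lemma dual_pairing (a4 a5 a6 a7 u : 'cV[R]_q) w :
  (forall i, 0 <= a4 i 0) -> (forall i, 0 <= a5 i 0) ->
  (forall i, 0 <= a6 i 0) -> (forall i, 0 <= a7 i 0) ->
  vsum a4 + vsum a5 <= alpha * w ->
  (forall i, a6 i 0 + a7 i 0 <= (1 - alpha) * w) ->
  `|dot (a4 - a5 - a6 + a7) u| <= w * (alpha * linfnorm u + (1 - alpha) * l1norm u).
Proof.
move=> a40 a50 a60 a70 a45 a67; apply: le_trans (ler_norm_sum _ _ _) _.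
apply: (@le_trans _ _ (\sum_i ((a4 i 0 + a5 i 0) * linfnorm u
                               + (1 - alpha) * w * `|u i 0|))).
  apply: ler_sum => i _; rewrite !mxE normrM.
  apply: (@le_trans _ _ ((a4 i 0 + a5 i 0 + (a6 i 0 + a7 i 0)) * `|u i 0|)).
    rewrite ler_wpM2r// ler_norml.
    by have := a40 i; have := a50 i; have := a60 i; have := a70 i; lra.
  rewrite mulrDl lerD// ?ler_wpM2r// ler_wpM2l ?addr_ge0//.
  exact: le_linfnorm.
rewrite big_split /= -mulr_suml -mulr_sumr big_split /= -/(vsum a4) -/(vsum a5).
have := ler_wpM2r (linfnorm_ge0 u) a45; rewrite /l1norm.
by set S := \sum_i `|u i 0|; lra.
Qed.

(** Weak duality with [h = w4 - w5 - w6 + w7]. The zero gap gives [vsum t = dot y (M h) - tau * w3],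
    which for feasible [z] equals [dot z (w1 - w2) - dot (theta z) h - tau * w3]. The first term is
    at most [l1norm z]; the others sum to at most 0 by [dual_pairing]. *)
Lemma kkt_optimal x t r s w1 w2 w3 w4 w5 w6 w7 :
  polysys M1 M2 rhs 0 (kktvec x t r s w1 w2 w3 w4 w5 w6 w7) ->
  P_optimal A M y tau alpha x.
Proof.
move=> []; rewrite matM1_kktvec matM2_kktvec.
move=> /lev_col[c1] /lev_col[c2] /lev_col[c3] /lev_col[c4] /lev_col[c5] /lev_col[c6].
move=> /lev_col[c7] /lev_col[c8] /lev_col[c9] /lev_col[c10] /lev_col[c11] /lev_col[c12].
move=> /lev_col[c13] /lev_col[c14] /lev_col[c15] /lev_col[c16] c17.
rewrite -[0 in RHS]vsubmxK => /eq_col_mx[/eqP e1 e2].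
have {}e2 : vsum t + tau * w3 - dot y (M *m (w4 - w5 - w6 + w7)) = 0.
  by have := congr1 (fun u : 'cV_1 => u 0 0) e2; rewrite !mxE eqxx mulr1n.
have {}e1 : A^T *m (M *m (w4 - w5 - w6 + w7)) = w1 - w2.
  move: e1; rewrite [usubmx _](_ : _ = 0) => [|]; last by apply/colP => i; rewrite !mxE.
  by rewrite addr_eq0 -eqr_oppLR opprB => /eqP.
have {}c3 : alpha * r + (1 - alpha) * vsum s <= tau by have := c3 0; rewrite !mxE eqxx.
have {}c9 : vsum w4 + vsum w5 <= alpha * w3.
  by have := c9 0; rewrite !mxE eqxx !mulr1n; lra.
have w30 : 0 <= w3 by have := c13 0; rewrite !mxE eqxx !mulr1n oppr_le0.
have w10 i : 0 <= w1 i 0 by have := c11 i; rewrite !mxE oppr_le0.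
have w20 i : 0 <= w2 i 0 by have := c12 i; rewrite !mxE oppr_le0.
have w40 i : 0 <= w4 i 0 by have := c14 i; rewrite !mxE oppr_le0.
have w50 i : 0 <= w5 i 0 by have := c15 i; rewrite !mxE oppr_le0.
have w60 i : 0 <= w6 i 0 by have := c16 i; rewrite !mxE oppr_le0.
have w70 i : 0 <= w7 i 0 by have := c17 i; rewrite !mxE oppr_le0.
have {}c10 i : w6 i 0 + w7 i 0 <= (1 - alpha) * w3.
  by have := c10 i; rewrite !mxE subr_le0.
have th_r i : `|th x i 0| <= r.
  rewrite thetaE; have := c4 i; have := c5 i.
  by rewrite !(cvE_add, cvE_opp, cvE_const) ler_norml; lra.
have th_s i : `|th x i 0| <= s i 0.
  rewrite thetaE; have := c6 i; have := c7 i.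
  by rewrite !(cvE_add, cvE_opp) ler_norml; lra.
have /andP[al0 al1] := alpha01.
split.
  rewrite /P_feasible /P_constraint.
  have l1s : l1norm (th x) <= vsum s by apply: ler_sum.
  have [r0|r0] := leP 0 r.
    apply: le_trans c3; apply: lerD; last by rewrite ler_wpM2l ?subr_ge0.
    by rewrite ler_wpM2l// linfnorm_le.
  (* A negative [r] satisfies the constraints only when [q = 0]. *)
  have q0 (i : 'I_q) : False.
    by have := le_lt_trans (le_trans (normr_ge0 _) (th_r i)) r0; rewrite ltxx.
  have -> : linfnorm (th x) = 0.
    by apply/eqP; rewrite eq_le linfnorm_ge0 linfnorm_le// => i; case: (q0 i).
  rewrite /l1norm big1 => [|i _]; last by case: (q0 i).
  by rewrite !mulr0 addr0.
move=> z; rewrite /P_feasible => zfeas.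
apply: (@le_trans _ _ (vsum t)).
  apply: ler_sum => i _; have := c1 i; have := c2 i.
  by rewrite !mxE ler_norml; lra.
have := dual_pairing (th z) w40 w50 w60 w70 c9 c10.
rewrite dotC ler_norml => /andP[pair _].
have : w3 * P_constraint A M y alpha z <= w3 * tau by rewrite ler_wpM2l.
have := dot_yM z (w4 - w5 - w6 + w7); rewrite e1.
have : dot z (w1 - w2) <= l1norm z.
  apply: dot_le_l1norm => i; have := c8 i; have := w10 i; have := w20 i.
  by rewrite !mxE ler_norml; lra.
by move: pair e2; rewrite /P_constraint; lra.
Qed.

End Optimality.

(** * Residuals and nonemptiness of the polyhedron *)

Section Existence.
Variables (R : realType) (m n q : nat).
Variables (A : 'M[R]_(m, n)) (M : 'M[R]_(m, q)).
Variables (y : 'cV[R]_m) (tau alpha : R).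

Notation M1 := (matM1 A M alpha).
Notation M2 := (matM2 A M y tau).
Notation th := (theta A M y).
Notation rhs := (kktrhs n M y tau).

Definition colabs p (u : 'cV[R]_p) : 'cV[R]_p := \col_i `|u i 0|.

Lemma vsum_colabs p (u : 'cV[R]_p) : vsum (colabs u) = l1norm u.
Proof. by apply: eq_bigr => i _; rewrite mxE. Qed.

Lemma posl1_col_nonpos p1 p2 (u : 'cV[R]_p1) (v : 'cV[R]_p2) :
  nonpos u -> posl1 (col_mx u v) = posl1 v.
Proof. by move=> u0; rewrite posl1_col posl1_nonpos ?add0r. Qed.

Lemma posl1_eq0 p (u : 'cV[R]_p) : posl1 u = 0 -> nonpos u.
Proof.
move=> /eqP; rewrite psumr_eq0 => [/allP u0 i|i _]; last by rewrite le_max lexx orbT.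
by have := u0 i; rewrite mem_index_enum => /(_ isT) /eqP <-; rewrite le_max lexx.
Qed.

(** With [t], [r], [s] chosen tight and admissible multipliers, only the row of [tau] can fail.
    Stationarity is not assumed, so the lemma serves both for zero multipliers and for those of the
    certificate. *)
Lemma kkt_residual x (w1 w2 : 'cV[R]_n) w3 (w4 w5 w6 w7 : 'cV[R]_q) :
  (forall i, w1 i 0 + w2 i 0 <= 1) ->
  vsum w4 + vsum w5 <= alpha * w3 ->
  (forall i, w6 i 0 + w7 i 0 <= (1 - alpha) * w3) ->
  (forall i, 0 <= w1 i 0) -> (forall i, 0 <= w2 i 0) -> 0 <= w3 ->
  (forall i, 0 <= w4 i 0) -> (forall i, 0 <= w5 i 0) ->
  (forall i, 0 <= w6 i 0) -> (forall i, 0 <= w7 i 0) ->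
  posl1 (M1 *m kktvec x (colabs x) (linfnorm (th x)) (colabs (th x))
                 w1 w2 w3 w4 w5 w6 w7 - rhs)
  = Num.max (P_constraint A M y alpha x - tau) 0.
Proof.
move=> w12 w45 w67 w10 w20 w30 w40 w50 w60 w70.
have absE p (u : 'cV[R]_p) i : colabs u i 0 = `|u i 0| by rewrite mxE.
have thE i : (M^T *m (A *m x)) i 0 = th x i 0 + (M^T *m y) i 0.
  by rewrite thetaE cvE_add cvE_opp; lra.
have thinf i : `|th x i 0| <= linfnorm (th x) by exact: le_linfnorm.
have npN p (u : 'cV[R]_p) : (forall i, 0 <= u i 0) -> nonpos (- u).
  by move=> u0 i; rewrite cvE_opp oppr_le0.
have absP (a : R) : a <= `|a| /\ - a <= `|a| by rewrite ler_norm -normrN ler_norm.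
have scal (a b : R) : (a%:M - b%:M : 'cV_1) = (a - b)%:M by rewrite -raddfB.
have np1 (a : R) : a <= 0 -> nonpos (a%:M : 'cV_1).
  by move=> a0 i; rewrite ord1 !mxE eqxx.
rewrite matM1_kktvec /kktlhs /kktrhs !opp_col_mx !add_col_mx !scal !subr0.
rewrite posl1_col_nonpos; last first.
  by move=> i; rewrite cvE_add cvE_opp absE; have := absP (x i 0); lra.
rewrite posl1_col_nonpos; last first.
  by move=> i; rewrite cvE_add !cvE_opp absE; have := absP (x i 0); lra.
rewrite posl1_col posl1_scalar vsum_colabs -[RHS]addr0; congr (_ + _).
rewrite posl1_col_nonpos; last first.
  move=> i; rewrite !(cvE_add, cvE_opp, cvE_const) thE.
  by have := absP (th x i 0); have := thinf i; lra.
rewrite posl1_col_nonpos; last first.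
  move=> i; rewrite !(cvE_add, cvE_opp, cvE_const) thE.
  by have := absP (th x i 0); have := thinf i; lra.
rewrite posl1_col_nonpos; last first.
  by move=> i; rewrite !(cvE_add, cvE_opp, absE) thE; have := absP (th x i 0); lra.
rewrite posl1_col_nonpos; last first.
  by move=> i; rewrite !(cvE_add, cvE_opp, absE) thE; have := absP (th x i 0); lra.
rewrite posl1_col_nonpos; last by move=> i; rewrite !(cvE_add, cvE_opp, cvE_const) subr_le0.
rewrite posl1_col_nonpos; last by apply: np1; lra.
rewrite posl1_col_nonpos; last by move=> i; rewrite !(cvE_add, cvE_opp, cvE_const) subr_le0.
by rewrite !posl1_col_nonpos ?posl1_nonpos//; do ?[exact: npN]; apply: np1; rewrite oppr_le0.
Qed.

(** Strong duality from Farkas' lemma for the joint primal-dual system. The multiplier [k] of the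
    duality gap decides: for [k <= 0] a certificate is refuted by a primal feasible point, otherwise
    by a point built from its own blocks. *)
Lemma kkt_exists x0 : P_feasible A M y tau alpha x0 ->
  exists z, polysys M1 M2 rhs 0 z.
Proof.
move=> x0feas; have [//|[p [s [p0 ps lt0]]]] := farkas M1 M2 rhs 0; exfalso.
have ident z : dot p (M1 *m z) + dot s (M2 *m z) = 0.
  by rewrite !dot_mulmxr -dotDl ps dot0l.
rewrite dot0r addr0 in lt0; clear ps.
have [xi [k' sE]] := col_mx_ex s; have [k kE] := scalar_ex k'.
rewrite {}kE in sE.
have [k0|k0] := leP k 0.
  (* With zero multipliers the gap is [l1norm x0] and contributes [k * l1norm x0 <= 0], while
     [dot p (M1 z) <= dot p rhs < 0]; their sum cannot vanish. *)
  pose z := kktvec x0 (colabs x0) (linfnorm (th x0)) (colabs (th x0)) 0 0 0 0 0 0 0.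
  have zero0 l (i : 'I_l) : 0 <= (0 : 'cV[R]_l) i 0 by rewrite mxE.
  have vsum0 l : vsum (0 : 'cV[R]_l) = 0 by apply: big1 => i _; rewrite mxE.
  have : posl1 (M1 *m z - rhs) = 0.
    rewrite kkt_residual; rewrite ?vsum0 ?addr0 ?mulr0 ?subr_le0//; last first.
    - by move=> i; rewrite !mxE addr0.
    - by move=> i; rewrite !mxE addr0 ler01.
    by apply/max_idPr; rewrite subr_le0.
  move=> /posl1_eq0 np.
  have : dot p (M1 *m z - rhs) <= 0.
    by apply: sumr_le0 => i _; rewrite mulr_ge0_le0.
  have := ident z; rewrite matM2_kktvec sE dot_col dot_scalar vsum_colabs.
  rewrite !(subrr, addr0, mulmx0, dot0r, mulr0, add0r) dotBr.
  have : k * l1norm x0 <= 0 by rewrite mulr_le0_ge0 ?l1norm_ge0.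
  by move: lt0; lra.
have [p1 [p' [E p1_0 {}p0]]] := nonneg_col_ex p0; rewrite {}E in lt0 ident.
have [p2 [p'' [E p2_0 {}p0]]] := nonneg_col_ex p0; rewrite {}E in lt0 ident.
have [q3 [p3' [E q3_0 {}p0]]] := nonneg_col_ex p0; rewrite {}E in lt0 ident.
have [p3 E p3_0] := nonneg_scalar_ex q3_0; rewrite {q3 q3_0}E in lt0 ident.
have [p4 [p4' [E p4_0 {}p0]]] := nonneg_col_ex p0; rewrite {}E in lt0 ident.
have [p5 [p5' [E p5_0 {}p0]]] := nonneg_col_ex p0; rewrite {}E in lt0 ident.
have [p6 [p6' [E p6_0 {}p0]]] := nonneg_col_ex p0; rewrite {}E in lt0 ident.
have [p7 [p7' [E p7_0 {}p0]]] := nonneg_col_ex p0; rewrite {}E in lt0 ident.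
have [p8 [p8' [E p8_0 {}p0]]] := nonneg_col_ex p0; rewrite {}E in lt0 ident.
have [q9 [p9' [E q9_0 {}p0]]] := nonneg_col_ex p0; rewrite {}E in lt0 ident.
have [p9 E p9_0] := nonneg_scalar_ex q9_0; rewrite {q9 q9_0}E in lt0 ident.
have [p10 [p10' [E p10_0 {}p0]]] := nonneg_col_ex p0; rewrite {}E in lt0 ident.
have [p11 [p11' [E p11_0 {}p0]]] := nonneg_col_ex p0; rewrite {}E in lt0 ident.
have [p12 [p12' [E p12_0 {}p0]]] := nonneg_col_ex p0; rewrite {}E in lt0 ident.
have [q13 [p13' [E q13_0 {}p0]]] := nonneg_col_ex p0; rewrite {}E in lt0 ident.
have [p13 E p13_0] := nonneg_scalar_ex q13_0; rewrite {q13 q13_0}E in lt0 ident.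
have [p14 [p14' [E p14_0 {}p0]]] := nonneg_col_ex p0; rewrite {}E in lt0 ident.
have [p15 [p15' [E p15_0 {}p0]]] := nonneg_col_ex p0; rewrite {}E in lt0 ident.
have [p16 [p17 [E p16_0 p17_0]]] := nonneg_col_ex p0; rewrite {}E in lt0 ident.
rewrite /kktrhs !dot_col !dot_scalar !dot0r !dot_const dotNr mulr0 in lt0.
rewrite !dotNr in lt0.
(* The system is skew: with this choice all terms cancel except those of the
   sign constraints and of the duality gap, and the latter has the sign of
   [dot p rhs]. *)
have := ident (kktvec xi p8 p9 p10 p1 p2 p3 p5 p4 p6 p7).
rewrite matM1_kktvec matM2_kktvec sE /kktlhs !dot_col !dot_scalar.
rewrite !(dotDr, dotNr, dot_const, mulmxDr, mulmxN).
rewrite (dotC p8 p1) (dotC p8 p2) (dotC p10 p6) (dotC p10 p7).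
rewrite ![dot xi (A^T *m _)]dot_mulmxr !trmxK ![dot (A *m xi) (M *m _)]dot_mulmxr.
rewrite ![dot (M^T *m (A *m xi)) _]dotC ![dot xi _]dotC.
rewrite ![dot y (M *m _)]dot_mulmxr ![dot (M^T *m y) _]dotC.
have g1 := dot_nonneg p11_0 p1_0; have g2 := dot_nonneg p12_0 p2_0.
have g3 := mulr_ge0 p13_0 p3_0; have g4 := dot_nonneg p14_0 p5_0.
have g5 := dot_nonneg p15_0 p4_0; have g6 := dot_nonneg p16_0 p6_0.
have g7 := dot_nonneg p17_0 p7_0.
have : k * (vsum p8 + tau * p3 -
    (dot p5 (M^T *m y) - dot p4 (M^T *m y) - dot p6 (M^T *m y) +
     dot p7 (M^T *m y))) < 0.
  by rewrite pmulr_rlt0//; move: lt0; lra.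
by lra.
Qed.

End Existence.

(** * Weak stability *)

Section Stability.
Variables (R : realType) (m n q k : nat).
Variables (A : 'M[R]_(m, n)) (M : 'M[R]_(m, q)).
Variables (y : 'cV[R]_m) (tau alpha : R).
Hypotheses (rA : \rank A = m) (rM : \rank M = m).
Hypothesis tau0 : 0 <= tau.
Hypothesis alpha01 : 0 <= alpha <= 1.

Notation th := (theta A M y).

Lemma linfnorm_le_l1norm p (u : 'cV[R]_p) : linfnorm u <= l1norm u.
Proof. by apply: linfnorm_le => [|i]; [exact: l1norm_ge0|exact: le_l1norm]. Qed.

Lemma const_c_ge0 : 0 <= const_c A M.
Proof. exact: bigmax_ge_id. Qed.

Lemma dot_le_linf_l1 p (u v : 'cV[R]_p) : `|dot u v| <= linfnorm u * l1norm v.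
Proof.
apply: le_trans (ler_norm_sum _ _ _) _; rewrite mulr_sumr; apply: ler_sum => i _.
by rewrite normrM ler_wpM2r// le_linfnorm.
Qed.

Lemma P_feasible_exists : exists x0, P_feasible A M y tau alpha x0.
Proof.
exists (A^T *m (invmx (A *m A^T) *m y)).
have th0 : th (A^T *m (invmx (A *m A^T) *m y)) = 0.
  by rewrite /theta !mulmxA mulmxV ?gram_unitmx// mul1mx subrr mulmx0.
rewrite /P_feasible /P_constraint th0 /linfnorm normr0 /l1norm big1 ?mulr0 ?addr0//.
by move=> i _; rewrite mxE normr0.
Qed.

Lemma split_sign p (u : 'cV[R]_p) : exists a b : 'cV[R]_p,
  [/\ u = a - b, forall i, 0 <= a i 0, forall i, 0 <= b i 0,
      forall i, a i 0 + b i 0 = `|u i 0| & vsum a + vsum b = l1norm u].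
Proof.
exists (\col_i ((`|u i 0| + u i 0) / 2)), (\col_i ((`|u i 0| - u i 0) / 2)).
split; [apply/colP => i|move=> i|move=> i|move=> i|].
- by rewrite !mxE; lra.
- by rewrite mxE; have := ler_norm (- u i 0); rewrite normrN; lra.
- by rewrite mxE; have := ler_norm (u i 0); lra.
- by rewrite !mxE; lra.
by rewrite /vsum -big_split; apply: eq_bigr => i _; rewrite !mxE /=; lra.
Qed.

Lemma vsumZ p a (u : 'cV[R]_p) : vsum (a *: u) = a * vsum u.
Proof. by rewrite /vsum mulr_sumr; apply: eq_bigr => i _; rewrite mxE. Qed.

Theorem weak_stability (x : 'cV[R]_n) : weak_RSP A k ->
  exists2 xs : 'cV[R]_n, P_optimal A M y tau alpha xs &
    l2norm (x - xs) <= robinson_gamma A M y tau alpha *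
      (Num.max (P_constraint A M y alpha x - tau) 0 + 2 * best_approx1 k x
       + const_c A M * (tau + linfnorm (th x))).
Proof.
move=> rsp; have [v v1 gap] := weak_RSP_certificate x rsp.
have [h Mh hc] := const_c_certificate rA rM v1.
have /andP[al0 al1] := alpha01; have al1' : 0 <= 1 - alpha by rewrite subr_ge0.
have [w1 [w2 [w12 w10 w20 w12s _]]] := split_sign (A^T *m v).
have [hp [hm [hE hp0 hm0 hs hv]]] := split_sign h.
(* Splitting [h] in the ratio alpha to 1 - alpha gives [w4] and [w5] total mass [alpha * l1norm h],
   and [w6 + w7] entries at most [(1 - alpha) * l1norm h]: what [w3 = l1norm h] allows. The order
   [hm], [hp] in [w6], [w7] makes the signed combination equal to [h]. *)
pose z := kktvec x (colabs x) (linfnorm (th x)) (colabs (th x)) w1 w2 (l1norm h)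
  (alpha *: hp) (alpha *: hm) ((1 - alpha) *: hm) ((1 - alpha) *: hp).
have hE' : alpha *: hp - alpha *: hm - (1 - alpha) *: hm + (1 - alpha) *: hp = h.
  by rewrite [RHS]hE; apply/colP => i; rewrite !mxE; ring.
have scal0 a p (u : 'cV[R]_p) : 0 <= a -> (forall i, 0 <= u i 0) ->
    forall i, 0 <= (a *: u) i 0.
  by move=> a0 u0 i; rewrite mxE mulr_ge0.
have res1 : posl1 (matM1 A M alpha *m z - kktrhs n M y tau)
    = Num.max (P_constraint A M y alpha x - tau) 0.
  apply: kkt_residual; rewrite ?l1norm_ge0//; try exact: scal0.
  - by move=> i; rewrite w12s.
  - by rewrite !vsumZ -mulrDr hv.
  - by move=> i; rewrite !mxE -mulrDr [hm i 0 + _]addrC hs ler_wpM2l ?le_l1norm.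
have res2 : l1norm (matM2 A M y tau *m z - 0)
    <= 2 * best_approx1 k x + const_c A M * (tau + linfnorm (th x)).
  (* Stationarity holds exactly. The remaining gap is [l1norm x - dot x (A^T v) + tau * l1norm h +
     dot (theta x) h]. *)
  rewrite subr0 matM2_kktvec hE' Mh w12 addrC addrA subrK subrr.
  rewrite l1norm_col {1}/l1norm big1 ?add0r => [|i _]; last by rewrite mxE normr0.
  rewrite /l1norm big_ord1 !mxE eqxx mulr1n vsum_colabs -/(l1norm h) -Mh (dot_yM A M y x) Mh.
  have := dot_le_linf_l1 (th x) h; rewrite ler_norml => /andP[].
  have := dot_le_l1norm x v1.
  have : (tau + linfnorm (th x)) * l1norm h <= (tau + linfnorm (th x)) * const_c A M.
    by rewrite ler_wpM2l// addr_ge0// linfnorm_ge0.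
  have := mulr_ge0 tau0 (l1norm_ge0 h).
  by move: gap; rewrite ler_norml => *; apply/andP; split; lra.
have [x0 x0feas] := P_feasible_exists.
have [zs zsP] := robinson_error_bound z (kkt_exists x0feas).
have [xs [t [r [s [u1 [u2 [u3 [u4 [u5 [u6 [u7 zsE]]]]]]]]]]] := kktvec_ex zs.
rewrite zsE in zsP * => dist; exists xs; first exact: kkt_optimal zsP.
apply: le_trans (le_trans dist _).
  by rewrite /z /kktvec opp_col_mx add_col_mx l2norm_col_le.
rewrite -addrA ler_wpM2l ?robinson_sigma_ge0// -/(posl1 _) res1 lerD2l.
exact: res2.
Qed.

End Stability.

Theorem corollary3p3 (R : realType) (m n q k : nat)
    (A : 'M[R]_(m, n)) (M : 'M[R]_(m, q)) (y : 'cV[R]_m) (tau alpha : R)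
    (hmn : (m < n)%N) (hmq : (m <= q)%N)
    (hA : \rank A = m) (hM : \rank M = m)
    (htau : 0 <= tau) (halpha : 0 <= alpha <= 1)
    (hcond :
      (* (a) *)
      [/\ l2_normalized A, (1 <= k <= n - 1)%N
        & mutual_coherence A k + mutual_coherence A (k - 1) < 1]
      (* (b) *)
      \/ (exists delta : R,
            [/\ 0 < delta < 1, RIP A (2 * k) delta
              & delta < (Num.sqrt 2)^-1])
      (* (c) *)
      \/ (exists rho : R, 0 < rho < 1 /\ stable_NSP A k rho)
      (* (d) *)
      \/ (exists (N : 'cV[R]_m -> R) (rho1 rho2 : R),
            [/\ is_norm N, 0 < rho1 < 1, 0 < rho2
              & robust_NSP A N k rho1 rho2])
      (* (e) *)
      \/ NSP A k
      (* (f) *)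
      \/ RSP_tr A k) :
  let gamma := robinson_gamma A M y tau alpha in
  let c := const_c A M in
  (forall x : 'cV[R]_n, exists2 xs : 'cV[R]_n,
     P_optimal A M y tau alpha xs &
     l2norm (x - xs) <=
       gamma * (Num.max (alpha * linfnorm (theta A M y x)
                         + (1 - alpha) * l1norm (theta A M y x) - tau) 0
                + 2 * best_approx1 k x
                + c * (tau + linfnorm (theta A M y x))))
  /\
  (forall x : 'cV[R]_n, P_feasible A M y tau alpha x ->
     exists2 xs : 'cV[R]_n,
       P_optimal A M y tau alpha xs &
       l2norm (x - xs) <=
         gamma * (2 * best_approx1 k x + c * tau
                  + c * linfnorm (M^T *m (A *m x - y)))
       /\ gamma * (2 * best_approx1 k x + c * tau
                   + c * linfnorm (M^T *m (A *m x - y)))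
          <= 2 * gamma * (best_approx1 k x + c * tau)).
Proof.
have rsp : weak_RSP A k.
  case: hcond => [[nrm k1 mu]|[[d [/andP[d0 _] rip d2]]|[[rho [/andP[_ rho1] nsp]]|
    [[N [rho1 [rho2 [Nnorm /andP[_ rho1lt] _ nsp]]]]|[nsp|rsp]]]]].
  - exact/weak_NSP_RSP/coherence_weak_NSP.
  - exact: weak_NSP_RSP (RIP_weak_NSP d0 d2 rip).
  - exact: weak_NSP_RSP (stable_NSP_weak rho1 nsp).
  - exact: weak_NSP_RSP (robust_NSP_weak Nnorm rho1lt nsp).
  - exact/weak_NSP_RSP/NSP_weak.
  - exact: RSP_weak.
move=> gamma c; split=> x; first exact: weak_stability.
move=> feas; have [xs xsopt dist] := weak_stability y hA hM htau halpha x rsp.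
have gamma0 : 0 <= gamma by exact: robinson_sigma_ge0.
exists xs => //; split.
  apply: le_trans dist _; rewrite ler_wpM2l// (_ : Num.max _ 0 = 0).
    by rewrite add0r mulrDr addrA.
  by apply/max_idPr; rewrite subr_le0.
(* The maximum norm is at most the l1-norm, hence at most their convex combination. *)
have th_tau : linfnorm (theta A M y x) <= tau.
  apply: le_trans feas; rewrite /P_constraint -{1}[linfnorm _]mul1r.
  rewrite -{1}(subrK alpha 1) addrC mulrDl lerD2l ler_wpM2l ?linfnorm_le_l1norm//.
  by move: halpha => /andP[_]; rewrite subr_ge0.
have := ler_wpM2l (const_c_ge0 A M) th_tau; rewrite -/c -/(theta A M y x) => c_th.
by rewrite [2 * gamma]mulrC -mulrA ler_wpM2l//; lra.
Qed.
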